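(* Let $G$ be a partial graph with a local coloring $\mathsf c$, containing at least one vertex, and equipped with an exit function, i.e., functions assigning to each $\Omega\in\mathfrak O$ an edge $\mathfrak e(\Omega)$ with endpoints $\mathfrak l(\Omega)$ a vertex of $\Omega$ and $\mathfrak w(\Omega)$ not a vertex of $\Omega$. Suppose that for every $\Omega\in\mathfrak O$: (H1) $(\mathfrak l(\Omega),\mathsf c(\mathfrak e(\Omega),\mathfrak l(\Omega)))$ is not a cusp-point, and (H2) $(\mathfrak w(\Omega),\mathsf c(\mathfrak e(\Omega),\mathfrak w(\Omega)))$ is a cusp-point. Then $G$ has a splitting vertex.
   Context: A partial graph is a triple $(\mathcal V,\mathcal E,\psi)$ of disjoint finite sets of vertices and edges and a function $\psi$ giving each edge a set of at most two endpoints. A sub-graph is given by $\mathcal V'\subseteq\mathcal V$, $\mathcal E'\subseteq\mathcal E$ with $\psi'(e)=\psi(e)\cap\mathcal V'$; union and inclusion of sub-graphs are componentwise. A path is an alternating sequence $(v_0,e_1,v_1,\dots,e_n,v_n)$ with the endpoints of $e_i$ exactly $v_{i-1}\neq v_i$; simple if edges are pairwise distinct and vertices pairwise distinct except possibly $v_0=v_n$; a cycle is a simple closed ($v_0=v_n$) path with at least one edge, viewed as a sub-graph. A sub-graph is connected if it is non-empty and any two of its vertices/edges are joined inside it (vertices by a path; edges if equal or incident to connected vertices; edge and vertex if the edge is incident to a vertex connected to it). A local coloring $\mathsf c$ assigns a color to each $(e,w)$ with $w$ an endpoint of $e$. A cusp is a triple $(e,w,f)$ of distinct edges incident to $w$ with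 $\mathsf c(e,w)=\mathsf c(f,w)=\alpha$; $(w,\alpha)$ is then a cusp-point. Cusps of a cycle: consecutive triples that are cusps, including (last edge, source, first edge); cusp-free means none. $\mathfrak O$ is the set of connected unions of cusp-free cycles of $G$ maximal for inclusion among such unions. A vertex $v$ is splitting if every cycle containing $v$ has a cusp at $v$. *)

(* Defs.v *)
From mathcomp Require Import all_boot.

Set Implicit Arguments.
Unset Strict Implicit.
Unset Printing Implicit Defensive.

Record pgraph := PGraph {
  vertex : finType;
  edge : finType;
  ends : edge -> {set vertex};
  card_ends : forall e : edge, #|ends e| <= 2
}.

Section SubGraphs.
Variable G : pgraph.

Definition sub_graph : finType := ({set vertex G} * {set edge G})%type.

Implicit Types H K : sub_graph.

Definition vertices H : {set vertex G} := H.1.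
Definition edges H : {set edge G} := H.2.

Definition sub_ends H (e : edge G) : {set vertex G} := ends e :&: vertices H.

Definition whole : sub_graph := ([set: vertex G], [set: edge G]).

Definition sub_incl H K : Prop :=
  vertices H \subset vertices K /\ edges H \subset edges K.

Definition sub_union (S : {set sub_graph}) : sub_graph :=
  (\bigcup_(H in S) vertices H, \bigcup_(H in S) edges H).

(* The sequence (v_0, e_1, v_1, ..., e_n, v_n) is encoded by its source v_0
   and the list [:: (e_1, v_1); ...; (e_n, v_n)]. *)
Fixpoint is_path H (x : vertex G) (p : seq (edge G * vertex G)) : Prop :=
  match p with
  | [::] => x \in vertices H
  | (e, y) :: q =>
      [/\ x \in vertices H, e \in edges H, x <> y,
          sub_ends H e = [set x; y] & is_path H y q]
  end.

Definition path_edges (p : seq (edge G * vertex G)) : seq (edge G) :=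
  [seq ev.1 | ev <- p].

(* Targets v_1, ..., v_n, i.e. all the vertices but the source. *)
Definition path_targets (p : seq (edge G * vertex G)) : seq (vertex G) :=
  [seq ev.2 | ev <- p].

Definition path_end (x : vertex G) (p : seq (edge G * vertex G)) : vertex G :=
  last x (path_targets p).

(* The only pair of positions lying neither both in v_0, ..., v_(n-1) nor both
   in v_1, ..., v_n is (0, n). *)
Definition simple_path (x : vertex G) (p : seq (edge G * vertex G)) : Prop :=
  [/\ uniq (path_edges p),
      uniq (belast x (path_targets p)) & uniq (path_targets p)].

Definition is_cycle (x : vertex G) (p : seq (edge G * vertex G)) : Prop :=
  [/\ is_path whole x p, simple_path x p, path_end x p = x & p <> [::]].

Definition path_sub_graph (x : vertex G) (p : seq (edge G * vertex G)) :
    sub_graph :=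
  ([set v in x :: path_targets p], [set e in path_edges p]).

Definition joined H (u v : vertex G) : Prop :=
  exists p, is_path H u p /\ path_end u p = v.

Definition connected H : Prop :=
  [/\ vertices H <> set0 \/ edges H <> set0,
      forall u v, u \in vertices H -> v \in vertices H -> joined H u v,
      forall e f, e \in edges H -> f \in edges H ->
        e = f \/
        exists u v, [/\ u \in sub_ends H e, v \in sub_ends H f & joined H u v]
    & forall e v, e \in edges H -> v \in vertices H ->
        exists u, u \in sub_ends H e /\ joined H u v].

End SubGraphs.

Definition local_coloring (G : pgraph) (C : Type) : Type :=
  forall (e : edge G) (w : vertex G), w \in ends e -> C.

Section Cusps.
Variables (G : pgraph) (C : Type) (c : local_coloring G C).

Definition cusp (e : edge G) (w : vertex G) (f : edge G) : Prop :=
  e <> f /\ exists (we : w \in ends e) (wf : w \in ends f), c we = c wf.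

Definition cusp_point (w : vertex G) (a : C) : Prop :=
  exists (e f : edge G) (we : w \in ends e), cusp e w f /\ c we = a.

(* Pairing each (e_i, v_i) with e_(i+1) cyclically; as v_n = v_0 in a cycle,
   the last triple is (e_n, v_0, e_1). *)
Definition cycle_cusp (p : seq (edge G * vertex G))
    (e : edge G) (w : vertex G) (f : edge G) : Prop :=
  ((e, w), f) \in zip p (rot 1 (path_edges p)) /\ cusp e w f.

Definition cusp_free (p : seq (edge G * vertex G)) : Prop :=
  forall e w f, ~ cycle_cusp p e w f.

Definition cusp_free_cycle (H : sub_graph G) : Prop :=
  exists x p, [/\ is_cycle x p, cusp_free p & H = path_sub_graph x p].

Definition connected_union (H : sub_graph G) : Prop :=
  connected H /\
  exists S : {set sub_graph G},
    (forall K, K \in S -> cusp_free_cycle K) /\ H = sub_union S.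

Definition maximal_connected_union (H : sub_graph G) : Prop :=
  connected_union H /\
  forall K, connected_union K -> sub_incl H K -> K = H.

Definition Omega : Type := {H : sub_graph G | maximal_connected_union H}.

Definition splitting (v : vertex G) : Prop :=
  forall x p, is_cycle x p -> v \in vertices (path_sub_graph x p) ->
    exists e f, cycle_cusp p e v f.

(* The domain is Omega itself, so that a graph without edges still has an
   exit function when it has no cusp-free cycle. *)
Record exit_function := ExitFunction {
  exit_edge : Omega -> edge G;
  exit_l : Omega -> vertex G;
  exit_w : Omega -> vertex G;
  exit_ends : forall O, ends (exit_edge O) = [set exit_l O; exit_w O];
  exit_l_in : forall O, exit_l O \in vertices (sval O);
  exit_w_out : forall O, exit_w O \notin vertices (sval O)
}.

Lemma exit_l_end (x : exit_function) (O : Omega) :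
  exit_l x O \in ends (exit_edge x O).
Proof. by rewrite exit_ends set21. Qed.

Lemma exit_w_end (x : exit_function) (O : Omega) :
  exit_w x O \in ends (exit_edge x O).
Proof. by rewrite exit_ends set22. Qed.

End Cusps.

(* Main.v *)
Require Import Defs.
From mathcomp Require Import all_boot boolp.

(** Call a pair (v, a) of a vertex and a color valid if it is a cusp-point, or
    if [a] is absent. Put (v, a) < (w, b) when some simple open cusp-free path
    runs from v to w, starts with a color other than a, ends with color b, and
    is never met again by a cusp-free path leaving w with a color other than b.
    This is a strict order: in a composite, a path coming back to the first
    component would extend the second one into a path coming back to it. So
    there is a maximal valid pair (v, a), and v is splitting.

    First, v lies in no Omega: otherwise follow Omega cusp-free from v to its
    exit l, then take the exit edge to w. A cusp-free path from w coming back to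
    Omega could be closed, through Omega and the exit edge, into a cusp-free
    cycle through w, against the maximality of Omega. Hence this path shows that
    (v, a) is below the cusp-point at w.

    Now suppose that some cycle has no cusp at v, and take such a cycle with the
    fewest cusps, not starting with color a. It has a first cusp, at u. If u is
    in no Omega, the initial segment from v to u shows that (v, a) is below the
    cusp-point at u. If u is in Omega, stop instead at the first vertex in
    Omega, go through Omega to l and take the exit edge. In both cases a
    cusp-free path coming back yields a cusp-free cycle where there is none, or
    a cycle at v with fewer cusps (lemma [detour]). *)

Set Implicit Arguments.
Unset Strict Implicit.
Unset Printing Implicit Defensive.

(** * Sequences, zips and maximal elements of a finite strict order *)

Lemma map_zip (T1 T2 U1 U2 : Type) (g : T1 -> U1) (h : T2 -> U2) s t :
  zip (map g s) (map h t) = [seq (g p.1, h p.2) | p <- zip s t].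
Proof. by elim: s t => [|x s IH] [|y t] //=; rewrite IH. Qed.

Lemma mem_zip (T U : eqType) (s : seq T) (t : seq U) p :
  p \in zip s t -> (p.1 \in s) && (p.2 \in t).
Proof.
elim: s t => [|x s IH] [|y t] //=.
rewrite !inE => /orP[/eqP->|/IH/andP[-> ->]]; rewrite ?eqxx ?orbT //.
Qed.

(** Once the sequence is rotated to start at [d], its last element [f] is the cyclic predecessor of
    [d]; [X] may be empty, in which case [d] is followed by [f] and then by [d] again. *)
Lemma mem_zip_rot (T : eqType) (s1 s2 X : seq T) d f : s2 ++ s1 = rcons X f ->
  (f, d) \in zip (s1 ++ d :: s2) (rot 1 (s1 ++ d :: s2)).
Proof.
case/lastP: s1 => [|s1 g].
  rewrite cats0 cat0s => ->; rewrite rot1_cons -rcons_cons.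
  by rewrite zip_rcons ?size_rcons //= mem_rcons mem_head.
rewrite -rcons_cat => /rcons_inj[_ ->]; rewrite cat_rcons.
case: s1 => [|h s1]; first by rewrite cat0s rot1_cons /= mem_head.
rewrite cat_cons rot1_cons -cat_cons rcons_cat rcons_cons.
rewrite -[s1 ++ f :: rcons _ _]cat_rcons.
by rewrite zip_cat ?size_rcons //= mem_cat mem_head orbT.
Qed.

Lemma uniq_map_inj (T U : eqType) (g : T -> U) (s : seq T) :
  uniq (map g s) -> {in s &, injective g}.
Proof.
elim: s => [|x s IH] //= /andP[xs us] y z; rewrite !inE.
case/orP=> [/eqP->|ys] /orP[/eqP->|zs] //; last exact: IH.
  by move=> e; case/negP: xs; rewrite e map_f.
by move=> e; case/negP: xs; rewrite -e map_f.
Qed.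

(** By induction on the number of elements above [x0]: moving up to a [y] loses at least [y] itself,
    by irreflexivity. *)
Lemma exists_max (T : finType) (P : T -> Prop) (R : T -> T -> Prop) x0 :
  (forall x, ~ R x x) -> (forall x y z, R x y -> R y z -> R x z) -> P x0 ->
  exists m, P m /\ forall y, P y -> ~ R m y.
Proof.
move=> irr tr; have [n] := ubnP #|[set y | `[< R x0 y >]]|.
elim: n x0 => // n IH x0; rewrite ltnS => le Px0.
have [[y [Py Rxy]]|nmax] := pselect (exists y, P y /\ R x0 y); last first.
  by exists x0; split=> // y Py Rxy; apply: nmax; exists y.
apply: (IH y) => //; apply: leq_trans le; apply: proper_card.
apply/properP; split.
  by apply/subsetP => z; rewrite !inE => /asboolP Ryz; apply/asboolP; apply: tr Ryz.
exists y; rewrite !inE; first exact/asboolP.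
by apply/asboolP; apply: irr.
Qed.

(** * Walks as sequences of darts *)

Section Darts.
Variables (V E : finType) (K : eqType) (inc : E -> {set V}) (k : E -> V -> K).

(** An edge with a direction of traversal, as (source, edge, target). Each item carries its own
    source, so that walks can be cut, rotated and reversed as mere lists. *)
Definition dart : eqType := (V * E * V)%type.

Implicit Types (d : dart) (s t p q : seq dart) (a b : option K) (x y z v w : V).

Definition src d : V := d.1.1.
Definition edg d : E := d.1.2.
Definition tgt d : V := d.2.
Definition flip d : dart := (tgt d, edg d, src d).
Definition is_dart d := (src d != tgt d) && (inc (edg d) == [set src d; tgt d]).
Definition kout d : K := k (edg d) (src d).
Definition kin d : K := k (edg d) (tgt d).

(** The final vertex is left out, so that [uniq (srcs s)] suits closed walks as well as open
    ones. *)
Definition srcs s : seq V := [seq src d | d <- s].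
Definition rs s : seq dart := rev [seq flip d | d <- s].

Fixpoint walk x s y : bool :=
  if s is d :: s' then [&& is_dart d, src d == x & walk (tgt d) s' y]
  else x == y.

Definition clash a b : bool := if a is Some c then b == Some c else false.
Definition fcol s : option K := if s is d :: _ then Some (kout d) else None.
Definition lcol a s : option K := last a [seq Some (kin d) | d <- s].

(* Cusps of a walk entered by an edge of color [a] and left by an edge of color
   [b], where [None] stands for the absence of such an edge. *)
Fixpoint ncusp a s b : nat :=
  if s is d :: s' then clash a (Some (kout d)) + ncusp (Some (kin d)) s' b
  else clash a b.

Definition cf a s b : bool := ncusp a s b == 0.

Lemma clash_sym a b : clash a b = clash b a.
Proof. by case: a b => [a|] [b|] //=; rewrite eq_sym. Qed.

Lemma clash_None a : clash a None = false. Proof. by case: a. Qed.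

Lemma srcs_cat s t : srcs (s ++ t) = srcs s ++ srcs t.
Proof. exact: map_cat. Qed.

Lemma rs_cat s t : rs (s ++ t) = rs t ++ rs s.
Proof. by rewrite /rs map_cat rev_cat. Qed.

Lemma rs_cons d s : rs (d :: s) = rcons (rs s) (flip d).
Proof. by rewrite /rs map_cons rev_cons. Qed.

Lemma lcol_cat a s t : lcol a (s ++ t) = lcol (lcol a s) t.
Proof. by rewrite /lcol map_cat last_cat. Qed.

Lemma lcol_nnil a s : s != [::] -> lcol a s = lcol None s.
Proof. by case: s. Qed.

Lemma fcol_cat s t : s != [::] -> fcol (s ++ t) = fcol s.
Proof. by case: s. Qed.

Lemma lcol_rs s : lcol None (rs s) = fcol s.
Proof. by case: s => [|d s] //; rewrite rs_cons /lcol map_rcons last_rcons. Qed.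

Lemma fcol_rs s : fcol (rs s) = lcol None s.
Proof.
elim/last_ind: s => [|s d _] //.
by rewrite -cats1 rs_cat lcol_cat.
Qed.

Lemma rs_eq0 s : (rs s == [::]) = (s == [::]).
Proof. by case: s => [|d s] //; rewrite rs_cons -size_eq0 size_rcons. Qed.

Lemma ncusp_cat a s t b :
  ncusp a (s ++ t) b = ncusp a s None + ncusp (lcol a s) t b.
Proof.
elim: s a => [|d s IH] a /=; first by rewrite clash_None.
by rewrite IH addnA.
Qed.

Lemma cf_cat a s t b : cf a (s ++ t) b = cf a s None && cf (lcol a s) t b.
Proof. by rewrite /cf ncusp_cat addn_eq0. Qed.

Lemma ncusp_split a s b : s != [::] ->
  ncusp a s b = clash a (fcol s) + ncusp None s None + clash (lcol None s) b.
Proof.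
move=> s0.
have -> : ncusp a s b = ncusp a s None + clash (lcol a s) b.
  by rewrite -[in LHS](cats0 s) ncusp_cat.
by rewrite lcol_nnil //; case: s s0.
Qed.

Lemma cf_split a s b : s != [::] ->
  cf a s b = [&& ~~ clash a (fcol s), cf None s None & ~~ clash (lcol None s) b].
Proof.
by move=> s0; rewrite /cf ncusp_split // !addn_eq0 !eqb0 andbA.
Qed.

Lemma cf_cons a d s b :
  cf a (d :: s) b = ~~ clash a (Some (kout d)) && cf (Some (kin d)) s b.
Proof. by rewrite /cf /= addn_eq0 eqb0. Qed.

Lemma cf_mid a s d t b :
  cf a (s ++ d :: t) b = cf a s (Some (kout d)) && cf (Some (kin d)) t b.
Proof.
elim: s a => [|e s IH] a /=; first by rewrite cf_cons /cf /= eqb0.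
by rewrite !cf_cons IH andbA.
Qed.

Lemma cf_rs a s b : cf a (rs s) b = cf b s a.
Proof.
elim: s a b => [|d s IH] a b; first by rewrite /cf /= clash_sym.
by rewrite rs_cons -cats1 cf_mid IH cf_cons andbC /cf /= !eqb0 -clash_sym.
Qed.

Lemma is_dart_flip d : is_dart (flip d) = is_dart d.
Proof. by rewrite /is_dart /src /tgt /= eq_sym setUC. Qed.

Lemma walk_cat x s y t z : walk x s y -> walk y t z -> walk x (s ++ t) z.
Proof.
elim: s x => [|d s IH] x /=; first by move/eqP->.
by case/and3P=> -> -> /= ws wt; apply: IH.
Qed.

Lemma walk_rs x s y : walk x s y -> walk y (rs s) x.
Proof.
elim: s x => [|d s IH] x /=; first by rewrite eq_sym.
case/and3P=> pd /eqP<- ws; rewrite rs_cons -cats1.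
by apply: (walk_cat (IH _ ws)); rewrite /= is_dart_flip pd !eqxx.
Qed.

(** The vertices of the walk in order, listed in two ways; this is what transfers facts on sources
    to targets, hence to reversed walks. *)
Lemma srcs_walk x s y : walk x s y ->
  rcons (srcs s) y = x :: [seq tgt d | d <- s].
Proof.
elim: s x => [|d s IH] x /=; first by move/eqP->.
by case/and3P=> _ /eqP<- /IH->.
Qed.

Lemma srcs_rs s : srcs (rs s) = rev [seq tgt d | d <- s].
Proof. by rewrite /srcs /rs map_rev -map_comp. Qed.

Lemma mem_srcs_rs x s y z : walk x s y ->
  (z \in x :: srcs (rs s)) = (z \in y :: srcs s).
Proof.
move=> ws; rewrite -[RHS]mem_rcons (srcs_walk ws) srcs_rs !inE.
by rewrite mem_rev.
Qed.

Lemma uniq_srcs_rs x s y : walk x s y ->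
  uniq (x :: srcs (rs s)) = uniq (y :: srcs s).
Proof.
by move=> ws; rewrite -[RHS]rcons_uniq (srcs_walk ws) srcs_rs /= mem_rev rev_uniq.
Qed.

Lemma walk_split_src x s d t y : walk x (s ++ d :: t) y ->
  walk x s (src d) /\ walk (src d) (d :: t) y.
Proof.
elim: s x => [|e s IH] x.
  by move=> /= /and3P[-> /eqP<- ->]; rewrite !eqxx.
by rewrite cat_cons /= => /and3P[-> -> /IH].
Qed.

Lemma walk_first x d s y : walk x (d :: s) y -> src d = x.
Proof. by case/and3P=> _ /eqP. Qed.

Lemma srcs_split z s : z \in srcs s ->
  exists s1 d s2, s = s1 ++ d :: s2 /\ src d = z.
Proof.
case/mapP=> d /path.splitPr[s1 s2] ->.
by exists s1, d, s2.
Qed.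

(** The end [y] counts as a possible hit, in which case [s2] is empty. *)
Lemma first_hit (B : pred V) x s y : walk x s y -> has B (rcons (srcs s) y) ->
  exists s1 z s2,
    [/\ s = s1 ++ s2, walk x s1 z, walk z s2 y, B z & ~~ has B (srcs s1)].
Proof.
elim: s x => [|d s IH] x /=.
  by move=> /eqP<-; rewrite orbF => Bx; exists [::], x, [::]; rewrite /= !eqxx.
case/and3P=> pd /eqP<- ws hB.
have [Bd|nBd] := boolP (B (src d)).
  by exists [::], (src d), (d :: s); rewrite /= pd !eqxx.
move: hB; rewrite (negbTE nBd) => /(IH _ ws)[s1 [z [s2 [-> w1 w2 Bz h1]]]].
by exists (d :: s1), z, s2; rewrite /= pd eqxx w1 w2 (negbTE nBd).
Qed.

Lemma last_hit (B : pred V) s : has B (srcs s) ->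
  exists s1 d s2, [/\ s = s1 ++ d :: s2, B (src d) & ~~ has B (srcs s2)].
Proof.
elim: s => [|d s IH] //=.
have [/IH[s1 [e [s2 [-> Be h2]]]] _|h] := boolP (has B (srcs s)).
  by exists (d :: s1), e, s2.
by rewrite orbF => Bd; exists [::], d, s.
Qed.

Lemma uniq_srcs_cat s t : uniq (srcs s) -> uniq (srcs t) ->
  (forall z, z \in srcs s -> z \in srcs t -> False) -> uniq (srcs (s ++ t)).
Proof.
move=> us ut dis; rewrite srcs_cat cat_uniq us ut andbT /=.
by apply/hasPn => z zt; apply/negP => zs; apply: (dis z).
Qed.

Lemma uniq_srcs_catE s t : uniq (srcs (s ++ t)) ->
  [/\ uniq (srcs s), uniq (srcs t) &
      forall z, z \in srcs s -> z \in srcs t -> False].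
Proof.
rewrite srcs_cat cat_uniq => /and3P[us /hasPn dis ut]; split=> // z zs zt.
by move: (dis z zt); rewrite /= zs.
Qed.

(** * Cycles of darts, and the splicing of a returning path into a cycle *)

Definition vcycle v s : bool := [&& walk v s v, uniq (srcs s) & s != [::]].
Definition good v s : bool := vcycle v s && ~~ clash (lcol None s) (fcol s).
(** Entering [s] with the color of its own last dart makes [cf] see the cusp at the source as
    well. *)
Definition cfcycle v s : bool := vcycle v s && cf (lcol None s) s None.

Lemma good_cfcycle v s : good v s -> ncusp None s None = 0 -> cfcycle v s.
Proof.
rewrite /good /cfcycle => /andP[cs cl] n0; rewrite cs /=.
have s0 : s != [::] by case/and3P: cs.
by rewrite cf_split // cl clash_None /cf n0.
Qed.

Lemma cf_None a s b : cf a s b -> cf None s None.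
Proof.
case: (eqVneq s [::]) => [->|s0] //.
by rewrite cf_split // => /and3P[].
Qed.

Lemma cf_first a s b : cf a s b -> ~~ clash a (fcol s).
Proof.
case: (eqVneq s [::]) => [->|s0]; first by rewrite clash_None.
by rewrite cf_split // => /and3P[].
Qed.

Lemma cf_last a s b : cf a s b -> ~~ clash (lcol None s) b.
Proof.
case: (eqVneq s [::]) => [->|s0] //.
by rewrite cf_split // => /and3P[].
Qed.

Lemma cf_join a s b : ~~ clash a (fcol s) -> cf None s None ->
  ~~ clash (lcol None s) b -> s != [::] -> cf a s b.
Proof. by move=> ? ? ? s0; rewrite cf_split //; apply/and3P. Qed.

(* [A ++ Q] runs from [v] to [w] and [T ++ D] back from [w] to [v]; the walk
   [d :: q] leaves [w] and first comes back on [A] or on [D]. Splicing it in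
   gives either a cusp-free cycle through [d], or a cycle at [v] with fewer than
   [N] cusps. [Q] and [T] may meet each other. *)
Lemma detour (v w x : V) a A Q T D d q N :
  walk v (A ++ Q) w -> cf a (A ++ Q) None -> uniq (srcs (A ++ Q)) ->
  A != [::] -> w \notin srcs (A ++ Q) ->
  walk w (T ++ D) v -> uniq (srcs (T ++ D)) -> T != [::] ->
  ~~ clash (lcol None (T ++ D)) (fcol A) ->
  (forall z, z \in srcs A -> z \in srcs (T ++ D) -> False) ->
  (forall z, z \in srcs D -> z \in srcs (A ++ Q) -> False) ->
  ncusp None (T ++ D) None < N ->
  (forall s, good v s -> ~~ clash a (fcol s) -> N <= ncusp None s None) ->
  (forall u s, cfcycle u s -> src d \in srcs s -> tgt d \in srcs s -> False) ->
  walk w (d :: q) x -> uniq (srcs (d :: q)) ->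
  cf (lcol None (A ++ Q)) (d :: q) None -> ~~ clash (Some (kout d)) (fcol T) ->
  (forall z, z \in srcs q -> (z \in srcs (A ++ Q)) || (z \in srcs (T ++ D)) ->
     False) ->
  x \in srcs A \/ x \in srcs D -> False.
Proof.
move=> wP cP uP A0 wnP wR uR T0 vcl AR DP NR minN fresh wq uq cq clT qPR xAD.
have srcd : src d = w by case/and3P: wq => _ /eqP.
have R0 : T ++ D != [::] by case: (T) T0.
have wR' : w \in srcs (T ++ D).
  case: (T) T0 wR => [|e T'] //= _ /and3P[_ /eqP<- _].
  by rewrite in_cons eqxx.
have td : tgt d \in rcons (srcs q) x.
  by case/and3P: wq => _ _ /srcs_walk->; rewrite in_cons eqxx.
(* The detour is an open path, so that its reversal is simple too: [w] is the source of [T], hence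
   neither on [A] nor on [D]. *)
have wqx : w != x.
  case: xAD => [xA|xD]; apply/eqP=> wx; rewrite wx in wnP wR'.
    exact: AR xA wR'.
  move: uR; rewrite srcs_cat cat_uniq => /and3P[_ /hasPn h _].
  move: (h _ xD); rewrite -wx /=; case: (T) T0 wR => [|e T'] //= _.
  by case/and3P=> _ /eqP<-; rewrite in_cons eqxx.
have urs : uniq (srcs (rs (d :: q))) /\ forall z, z \in srcs (rs (d :: q)) ->
    z = x \/ z \in srcs q.
  have xq : x \notin srcs (d :: q).
    rewrite /= inE srcd eq_sym negb_or wqx; apply/negP => xq.
    apply: (qPR _ xq); rewrite !srcs_cat !mem_cat.
    by case: xAD => ->; rewrite ?orbT.
  have := uniq_srcs_rs wq; rewrite [RHS]cons_uniq xq [X in _ && X]uq => /andP[wrs urs].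
  split=> // z zrs; have := mem_srcs_rs z wq.
  rewrite inE zrs orbT => /esym; rewrite !inE => /or3P[/eqP|/eqP zw|]; auto.
  by rewrite zw srcd in zrs; rewrite zrs in wrs.
case: urs => urs mrs.
have trs : tgt d \in srcs (rs (d :: q)).
  by rewrite srcs_rs mem_rev inE eqxx.
have crs : cf None (d :: q) None := cf_None cq.
have wrs := walk_rs wq.
have dqP z : z \in srcs (A ++ Q) -> z \in srcs (d :: q) -> False.
  move=> zP; rewrite inE srcd => /orP[/eqP zw|zq].
    by rewrite -zw zP in wnP.
  by apply: (qPR _ zq); rewrite zP.
case: xAD => [xA|xD].
- case: (srcs_split xA) => A1 [e [A2 [defA srce]]].
  have defP : A ++ Q = A1 ++ (e :: A2 ++ Q) by rewrite defA -catA.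
  have [w1 w2] : walk v A1 x /\ walk x (e :: A2 ++ Q) w.
    by rewrite defP in wP; case/walk_split_src: (wP); rewrite srce.
  have [uA1 uP2 dP] : [/\ uniq (srcs A1), uniq (srcs (e :: A2 ++ Q)) &
     forall z, z \in srcs A1 -> z \in srcs (e :: A2 ++ Q) -> False].
    by apply: uniq_srcs_catE; rewrite -defP.
  have lP : lcol None (A ++ Q) = lcol None (e :: A2 ++ Q).
    by rewrite defP lcol_cat lcol_nnil.
  have [cA1 cP2] : cf a A1 (Some (kout e)) /\ cf None (e :: A2 ++ Q) None.
    by move: cP; rewrite defP cf_mid => /andP[-> h].
  (* Return on [A]: unless the detour arrives at [x] with the color of [e], the walk from [x] to [w]
     followed by the detour is a cusp-free cycle. *)
  have [J|nJ] := boolP (clash (lcol None (d :: q)) (Some (kout e))); last first.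
    apply: (fresh x ((e :: A2 ++ Q) ++ d :: q)).
    + apply/andP; split.
        apply/and3P; split=> //; first exact: walk_cat w2 wq.
        apply: uniq_srcs_cat => // z z1 z2; apply: dqP z2.
        by rewrite defP srcs_cat mem_cat z1 orbT.
      rewrite lcol_cat lcol_nnil // cf_cat lcol_nnil // -lP cq andbT.
      by apply: cf_join => //; rewrite clash_None.
    + by rewrite srcs_cat mem_cat orbC mem_head.
    + move: td; rewrite srcs_cat mem_cat mem_rcons in_cons.
      case/orP=> [/eqP->|tq]; first by rewrite -srce mem_head.
      by rewrite [tgt d \in srcs (d :: q)]in_cons tq !orbT.
  have JE : lcol None (d :: q) = Some (kout e).
    by move: J; rewrite /clash; case: lcol => // c /eqP.
  (* The reversed detour leaves [x] with the same color as [e], so it replaces [e :: A2 ++ Q]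
     without a new cusp, even when [A1] is empty and it gives the first color. All cusps of [s] are
     then those of [T ++ D]. *)
  pose s := A1 ++ rs (d :: q) ++ (T ++ D).
  have fs : fcol s = fcol A.
    rewrite /s defA; case: (A1) => [|? ?] //=.
    by rewrite fcol_cat ?rs_eq0 // fcol_rs JE.
  have gs : good v s.
    rewrite /good fs !lcol_cat -lcol_cat (lcol_nnil _ R0) vcl andbT.
    apply/and3P; split;
      last by rewrite -size_eq0 !size_cat; case: (T) T0 => // *; rewrite !addnS.
      exact: walk_cat w1 (walk_cat wrs wR).
    have A1A z : z \in srcs A1 -> z \in srcs A.
      by rewrite defA srcs_cat mem_cat => ->.
    apply: uniq_srcs_cat => //.
      apply: uniq_srcs_cat => // z /mrs[->|zq] zR; first exact: AR xA zR.
      by apply: (qPR _ zq); rewrite zR orbT.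
    move=> z z1; rewrite srcs_cat mem_cat => /orP[/mrs[zx|zq]|zR].
    + by apply: (dP _ z1); rewrite zx inE srce eqxx.
    + by apply: (qPR _ zq); rewrite srcs_cat mem_cat A1A.
    + exact: AR (A1A _ z1) zR.
  have := minN _ gs; rewrite fs.
  have -> : ~~ clash a (fcol A).
    by move/cf_first: cP; rewrite fcol_cat.
  move=> /(_ isT); rewrite leqNgt => /negP; apply.
  rewrite /s ncusp_cat (eqP (cf_None cA1 : cf None A1 None)) ncusp_cat.
  have -> : ncusp (lcol None A1) (rs (d :: q)) None = 0.
    apply/eqP; rewrite -/(cf _ _ _) cf_rs; apply: cf_join => //=.
    by rewrite JE clash_sym (cf_last cA1).
  rewrite lcol_nnil ?rs_eq0 // lcol_rs ncusp_split // clash_None addn0 !add0n.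
  by rewrite fcol_cat // (negbTE clT).
- case: (srcs_split xD) => D1 [e [D2 [defD srce]]].
  have defR : T ++ D = (T ++ D1) ++ (e :: D2) by rewrite defD -catA.
  have [w1 w2] : walk w (T ++ D1) x /\ walk x (e :: D2) v.
    by rewrite defR in wR; case/walk_split_src: (wR); rewrite srce.
  have [uT uD2 dR] : [/\ uniq (srcs (T ++ D1)), uniq (srcs (e :: D2)) &
     forall z, z \in srcs (T ++ D1) -> z \in srcs (e :: D2) -> False].
    by apply: uniq_srcs_catE; rewrite -defR.
  have TD0 : T ++ D1 != [::] by case: (T) T0.
  have P0 : A ++ Q != [::] by case: (A) A0.
  have lR : lcol None (T ++ D) = lcol None (e :: D2).
    by rewrite defR lcol_cat lcol_nnil.
  have D2D z : z \in srcs (e :: D2) -> z \in srcs D.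
    by rewrite defD srcs_cat mem_cat => ->; rewrite orbT.
  (* Return on [D]: compared with this cycle, the minimality of [N] forces a cusp between the detour
     and [e], and leaves none on [T ++ D1] nor between it and [e]. *)
  pose s := (A ++ Q) ++ (d :: q) ++ (e :: D2).
  have fs : fcol s = fcol A by rewrite /s fcol_cat // fcol_cat.
  have gs : good v s.
    rewrite /good fs /s !lcol_cat (lcol_nnil _ (isT : e :: D2 != [::])) -lR vcl.
    rewrite andbT; apply/and3P; split; last by case: (A) A0.
      exact: walk_cat wP (walk_cat wq w2).
    apply: uniq_srcs_cat => //.
      apply: uniq_srcs_cat => // z; rewrite inE srcd => /orP[/eqP->|zq] zD.
        apply: (dR w) => //; case: (T) T0 w1 => [|? ?] //= _ /and3P[_ /eqP<- _].
        by rewrite inE eqxx.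
      by apply: (qPR _ zq); rewrite [srcs (T ++ D)]srcs_cat mem_cat D2D ?orbT.
    move=> z z1; rewrite srcs_cat mem_cat => /orP[zq|zD]; first exact: dqP zq.
    exact: DP (D2D _ zD) z1.
  have := minN _ gs; rewrite fs.
  have -> : ~~ clash a (fcol A).
    by move/cf_first: cP; rewrite fcol_cat.
  move=> /(_ isT) leN; have ltN := leq_trans NR leN.
  move: ltN; rewrite /s (ncusp_cat _ (A ++ Q)) (eqP (cf_None cP)).
  rewrite (ncusp_cat _ (d :: q)).
  rewrite (eqP cq) !add0n defR ncusp_cat.
  have D20 : e :: D2 != [::] by [].
  rewrite (lcol_nnil _ (isT : d :: q != [::])).
  rewrite (ncusp_split (lcol None (d :: q)) _ D20).
  rewrite (ncusp_split (lcol None (T ++ D1)) _ D20).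
  rewrite !clash_None !addn0 addnA ltn_add2r [fcol (e :: D2)]/=.
  case J: (clash (lcol None (d :: q)) _) => //; rewrite ltnS leqn0 addn_eq0 eqb0.
  case/andP=> cT nclT.
  have JE : lcol None (d :: q) = Some (kout e).
    by move: J; rewrite /clash; case: lcol => // c /eqP.
  (* The reversed detour starts with the color of [e], which [T ++ D1] avoids at [x], so both
     together form a cusp-free cycle. *)
  apply: (fresh w ((T ++ D1) ++ rs (d :: q))) => //.
  + apply/andP; split.
      apply/and3P; split; [exact: walk_cat w1 wrs| |by case: (T) T0].
      apply: uniq_srcs_cat => // z zT /mrs[zx|zq].
        by apply: (dR _ zT); rewrite zx inE srce eqxx.
      apply: (qPR _ zq).
      by rewrite defR [srcs (_ ++ e :: D2)]srcs_cat
                 [z \in srcs _ ++ _]mem_cat zT orbT.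
    rewrite lcol_cat lcol_nnil ?rs_eq0 // lcol_rs cf_cat; apply/andP; split.
      by apply: cf_join; rewrite ?clash_None // fcol_cat.
    rewrite lcol_nnil // cf_rs; apply: cf_join => //=.
    by rewrite JE clash_sym.
  + rewrite srcd srcs_cat mem_cat.
    case: (T) T0 w1 => [|? ?] //= _ /and3P[_ /eqP<- _].
    by rewrite inE eqxx.
  + by rewrite srcs_cat mem_cat trs orbT.
Qed.

(** A form of [detour] for a path that is only known to avoid [Q] and [T]: it is cut at its first
    vertex on [A] or [D]. *)
Lemma detour_hit (v w z : V) a A Q T D d q N :
  walk v (A ++ Q) w -> cf a (A ++ Q) None -> uniq (srcs (A ++ Q)) ->
  A != [::] -> w \notin srcs (A ++ Q) ->
  walk w (T ++ D) v -> uniq (srcs (T ++ D)) -> T != [::] ->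
  ~~ clash (lcol None (T ++ D)) (fcol A) ->
  (forall x, x \in srcs A -> x \in srcs (T ++ D) -> False) ->
  (forall x, x \in srcs D -> x \in srcs (A ++ Q) -> False) ->
  ncusp None (T ++ D) None < N ->
  (forall s, good v s -> ~~ clash a (fcol s) -> N <= ncusp None s None) ->
  (forall u s, cfcycle u s -> src d \in srcs s -> tgt d \in srcs s -> False) ->
  walk w (d :: q) z -> uniq (srcs (d :: q)) ->
  cf (lcol None (A ++ Q)) (d :: q) None -> ~~ clash (Some (kout d)) (fcol T) ->
  (forall x, x \in rcons (srcs q) z -> (x \in srcs Q) || (x \in srcs T) ->
     False) ->
  z \in srcs A \/ z \in srcs D -> False.
Proof.
move=> wP cP uP A0 wnP wR uR T0 vcl AR DP NR minN fresh wq uq cq clT qQT zAD.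
have /and3P[pd sd wq'] := wq.
have hz : has [pred x | (x \in srcs A) || (x \in srcs D)] (rcons (srcs q) z).
  by rewrite has_rcons /=; case: zAD => ->; rewrite ?orbT.
have [s1 [x [s2 [defq w1 w2 Bx h1]]]] := first_hit wq' hz.
apply: (detour wP cP uP A0 wnP wR uR T0 vcl AR DP NR minN fresh
          (x := x) (q := s1)) => //.
- by rewrite /= pd sd.
- by move: uq; rewrite defq -cat_cons => /uniq_srcs_catE[].
- by move: cq; rewrite defq -cat_cons cf_cat => /andP[].
- move=> y y1; move/hasPn: h1 => /(_ _ y1) /=; rewrite negb_or => /andP[nA nD].
  rewrite !srcs_cat !mem_cat (negbTE nA) (negbTE nD) orbF /= => yQT.
  apply: (qQT y _ yQT).
  by rewrite defq srcs_cat mem_rcons inE mem_cat y1 orbT.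
- by case/orP: Bx; auto.
Qed.

Lemma dart_inc d : is_dart d -> src d \in inc (edg d) /\ tgt d \in inc (edg d).
Proof. by case/andP=> _ /eqP->; rewrite set21 set22. Qed.

Lemma walk_is_dart x s y d : walk x s y -> d \in s -> is_dart d.
Proof.
elim: s x => [|e s IH] x //= /and3P[pe _ ws].
by rewrite inE => /orP[/eqP->|]; last exact: IH ws.
Qed.

Lemma vcycle_walk_mid v X d Y : walk v (X ++ d :: Y) v ->
  walk v X (src d) /\ walk (tgt d) Y v.
Proof. by move=> /walk_split_src[wX /and3P[_ _ wY]]. Qed.

Lemma walk_head x s y : walk x s y -> s = [::] /\ x = y \/ x \in srcs s.
Proof.
case: s => [|d s] /=; first by move/eqP->; left.
by case/and3P=> _ /eqP<- _; right; rewrite inE eqxx.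
Qed.

(* An edge traversed twice by a vertex-simple cycle makes it a back-and-forth
   [:: d; flip d], which has a cusp at its source. *)
Lemma good_edges v X d Y e Z : good v (X ++ d :: Y ++ e :: Z) ->
  edg d != edg e.
Proof.
case/andP=> /and3P[ws us _] cl; apply/eqP => de.
have [wX wY] := vcycle_walk_mid ws.
have [wY1 wZ] : walk (tgt d) Y (src e) /\ walk (tgt e) Z v.
  by case/walk_split_src: wY => h /and3P[].
have /andP[nd /eqP id] : is_dart d.
  by apply: (walk_is_dart ws); rewrite mem_cat inE eqxx orbT.
have /andP[ne /eqP ie] : is_dart e.
  by apply: (walk_is_dart ws); rewrite mem_cat inE mem_cat inE eqxx !orbT.
have [_ u2 uX] := uniq_srcs_catE us.
have [ud _ uY] := uniq_srcs_catE (s := d :: Y) u2.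
have nde : src d != src e.
  apply/eqP => h; apply: (uY (src d)); first exact: mem_head.
  by rewrite h mem_head.
have sde : src d = tgt e.
  have : src d \in [set src e; tgt e] by rewrite -ie -de id set21.
  by rewrite !inE (negbTE nde) => /eqP.
have tde : tgt d = src e.
  have : src e \in [set src d; tgt d] by rewrite -id de ie set21.
  by rewrite !inE eq_sym (negbTE nde) => /eqP.
have Y0 : Y = [::].
  case: (walk_head wY1) => [[]//|h]; case: (uY (tgt d)).
    by rewrite [srcs _]/= inE h orbT.
  by rewrite tde mem_head.
subst Y; have Z0 : Z = [::] /\ src d = v.
  case: (walk_head wZ) => [[-> <-]//|h]; case: (uY (src d)); first exact: mem_head.
  by rewrite sde [srcs _]/= inE h orbT.
case: Z0 => ? dv; subst Z.
have X0 : X = [::].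
  case: (walk_head wX) => [[]//|h]; case: (uX _ h).
  by rewrite -dv mem_head.
by move: cl; rewrite X0 /lcol /= /kin /kout de -sde eqxx.
Qed.

(** * The strict order on pairs of a vertex and a color *)

Definition opath x p y : bool :=
  [&& walk x p y, uniq (srcs p), y \notin srcs p & p != [::]].

(** Any cusp-free path coming back to [p] can be cut at its first vertex on [p], which gives this
    form. *)
Definition returns w c p : Prop := exists q z,
  [/\ walk w q z, uniq (srcs q), cf c q None, z \in srcs p &
      ~~ has (mem (srcs p)) (srcs q)].

Definition cusp_color w c : Prop := exists f g,
  [/\ f != g, w \in inc f, w \in inc g, c = Some (k f w) & c = Some (k g w)].

Definition prec (x y : V * option K) : Prop :=
  exists p, [/\ opath x.1 p y.1, cf x.2 p None, lcol None p = y.2 &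
                ~ returns y.1 y.2 p].

Lemma prec_irrefl (x : V * option K) : ~ prec x x.
Proof.
case: x => v a [p [/and4P[/= wp _ vp p0] _ _ _]].
by case: (walk_head wp) => [[p1]|]; [rewrite p1 in p0|apply/negP].
Qed.

Lemma prec_trans (x y z : V * option K) : prec x y -> prec y z -> prec x z.
Proof.
case: x y z => [v a] [w b] [u c] [p /= [/and4P[wp up wnp p0] cp lp rp]].
case=> p' /= [/and4P[wp' up' unp' p0'] cp' lp' rp'].
(* If [p'] met [p], its initial segment would be a return to [p]. *)
have dis : ~~ has (mem (srcs p)) (rcons (srcs p') u).
  apply/negP => h; have [s1 [z [s2 [def w1 _ pz h1]]]] := first_hit wp' h.
  apply: rp; exists s1, z; split=> //.
    by move: up'; rewrite def => /uniq_srcs_catE[].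
  by move: cp'; rewrite def cf_cat => /andP[].
have [unp dis'] : u \notin srcs p /\ ~~ has (mem (srcs p)) (srcs p').
  by move: dis; rewrite has_rcons negb_or => /andP[].
exists (p ++ p'); split.
- apply/and4P; split; first exact: walk_cat wp wp'.
  + by rewrite srcs_cat cat_uniq up up' dis'.
  + by rewrite srcs_cat mem_cat negb_or unp.
  + by case: (p) p0.
- by rewrite cf_cat cp lcol_nnil // lp.
- by rewrite lcol_cat lcol_nnil.
- case=> q [z [wq uq cq]]; rewrite srcs_cat mem_cat => zpp' hq.
  have [nqp nqp'] : ~~ has (mem (srcs p)) (srcs q) /\
                    ~~ has (mem (srcs p')) (srcs q).
    split; apply/hasPn => t /(hasPn hq); rewrite /= mem_cat negb_or.
      by case/andP.
    by case/andP.
  have [zp'|nzp'] := boolP (z \in srcs p'); first by apply: rp'; exists q, z.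
  move: zpp'; rewrite (negbTE nzp') orbF => zp.
  (* Prefixed with [p'], a return from [u] to [p] becomes a return from [w] to [p]. *)
  apply: rp; exists (p' ++ q), z; split=> //.
  + exact: walk_cat wp' wq.
  + rewrite srcs_cat cat_uniq up' uq andbT /=.
    exact: nqp'.
  + by rewrite cf_cat cp' lcol_nnil // lp'.
  + by rewrite srcs_cat has_cat negb_or dis' nqp.
Qed.

Lemma first_cusp b s : ncusp b s None != 0 ->
  exists A d r, [/\ s = A ++ d :: r, cf b A None &
                    clash (lcol b A) (Some (kout d))].
Proof.
elim: s b => [|d s IH] b /=; first by rewrite clash_None.
have [J _|nJ] := boolP (clash b (Some (kout d))).
  by exists [::], d, s; rewrite /cf /= clash_None.
move=> /IH[A [e [r [-> cA cl]]]]; exists (d :: A), e, r; split=> //.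
by rewrite cf_cons nJ.
Qed.

(** What is used of an Omega and its exit edge. [region_conn] connects without cusps whatever the
    incoming color [a], [region_absorb] is maximality, and [region_h1] reads (H1) as: no other edge
    has the color of [e] at [l]. *)
Record exit_region (B : {set V}) (l w : V) (e : E) : Prop := ExitRegion {
  region_l : l \in B;
  region_w : w \notin B;
  region_ends : inc e = [set l; w];
  region_conn : forall u z a, u \in B -> z \in B -> exists s,
    [/\ walk u s z, uniq (srcs s), z \notin srcs s, cf a s None &
        {subset srcs s <= B}];
  region_absorb : forall v s, cfcycle v s -> has (mem B) (srcs s) ->
    {subset srcs s <= B};
  region_h1 : forall f, l \in inc f -> f != e -> k f l != k e l;
  region_h2 : cusp_color w (Some (k e w))
}.

(** * Leaving a region through its exit edge *)

Section Region.
Variables (B : {set V}) (l w : V) (e : E).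
Hypothesis reg : exit_region B l w e.

Let lB := region_l reg.
Let wB := region_w reg.

Lemma exit_lw : l != w.
Proof. by apply: contraNneq wB => <-. Qed.

Lemma exit_other d : is_dart d -> edg d = e ->
  (src d = l /\ tgt d = w) \/ (src d = w /\ tgt d = l).
Proof.
case/andP=> ne /eqP id de; move: id; rewrite de (region_ends reg) => id.
have : src d \in [set l; w] by rewrite id set21.
have : tgt d \in [set l; w] by rewrite id set22.
rewrite !inE => /orP[] /eqP td /orP[] /eqP sd; auto;
  by rewrite td sd eqxx in ne.
Qed.

(** By (H1) only [e] has its color at [l], and a dart along [e] that ends at [l] comes from [w]. *)
Lemma exit_in x s d : walk x (rcons s d) l ->
  clash (Some (kin d)) (Some (k e l)) -> src d = w /\ edg d = e.
Proof.
rewrite -cats1 => /walk_split_src[_ /and3P[pd _ /eqP tl]] /eqP[kl].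
case: (eqVneq (edg d) e) => [de|ne].
  case: (exit_other pd de) => [[_ tw]|[]//].
  by move: exit_lw; rewrite -tl tw eqxx.
have := region_h1 reg _ ne; rewrite -tl; case: (dart_inc pd) => _ -> /(_ isT).
by rewrite {2}tl kl /kin tl eqxx.
Qed.

Lemma exit_in_lcol x s : walk x s l -> clash (lcol None s) (Some (k e l)) ->
  exists s' d, [/\ s = rcons s' d, src d = w & edg d = e].
Proof.
case/lastP: s => [|s d] // wsd.
rewrite -cats1 lcol_cat => /(exit_in wsd)[? ?].
by exists s, d; rewrite cats1.
Qed.

Lemma exit_out d : is_dart d -> src d = l ->
  clash (Some (k e l)) (Some (kout d)) -> tgt d = w /\ edg d = e.
Proof.
move=> pd sl /eqP[kl].
case: (eqVneq (edg d) e) => [de|ne].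
  case: (exit_other pd de) => [[]//|[sw _]].
  by move: exit_lw; rewrite -sl sw eqxx.
have := region_h1 reg _ ne; rewrite -sl; case: (dart_inc pd) => -> _ /(_ isT).
by rewrite {2}sl -kl /kout sl eqxx.
Qed.

Definition exit_dart : dart := (l, e, w).

Lemma walk_exit : walk l [:: exit_dart] w.
Proof. by rewrite /= /is_dart exit_lw (region_ends reg) !eqxx. Qed.

Lemma exit_noreturn q z : walk w q z -> uniq (srcs q) ->
  cf (Some (k e w)) q None -> ~~ has (mem B) (rcons (srcs q) z).
Proof.
move=> wq uq cq; apply/negP => h.
have [s1 [y [s2 [defq w1 _ /= yB h1]]]] := first_hit wq h.
have s10 : s1 != [::].
  by apply: contraNneq wB => s10; move: w1; rewrite s10 /= => /eqP->.
have u1 : uniq (srcs s1) by move: uq; rewrite defq => /uniq_srcs_catE[].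
have c1 : cf (Some (k e w)) s1 None.
  by move: cq; rewrite defq cf_cat => /andP[].
have [t [wt ut lt ct tB]] := region_conn reg (lcol None s1) yB lB.
have w1t := walk_cat w1 wt.
(* A cusp at [l] would mean arriving there along [e] from [w]. As the last dart of [t] this puts [w]
   in [B]; as the only dart of [s1] it clashes at [w] with the given color; as a later dart of [s1]
   it repeats [w]. *)
have nl : ~~ clash (lcol None (s1 ++ t)) (Some (k e l)).
  apply/negP => /(exit_in_lcol w1t)[s' [d [def dw de]]].
  case/lastP: t wt ut lt ct tB w1t def => [|t d'] wt ut lt ct tB w1t def.
    rewrite cats0 in def; rewrite def in c1 u1 w1.
    case: (s') c1 u1 w1 => [|d1 s''] c1 u1 w1.
      move: c1; rewrite cf_cons /= -dw -de /kout.
      by rewrite eqxx.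
    have sd1 : src d1 = w := walk_first w1.
    move: u1; rewrite -cats1 => /uniq_srcs_catE[_ _ /(_ w)]; apply.
      by rewrite -sd1; exact: mem_head.
    by rewrite -dw; exact: mem_head.
  move: def; rewrite -rcons_cat => /rcons_inj[_ dd'].
  by move: wB; rewrite -dw -dd' tB // /srcs map_rcons mem_rcons mem_head.
(* Closed by the exit edge, the walk is a cusp-free cycle through [l] and [w], whose absorption
   would put [w] in [B]. *)
have cyc : cfcycle w ((s1 ++ t) ++ [:: exit_dart]).
  apply/andP; split.
    apply/and3P; split; [exact: walk_cat w1t walk_exit| |by case: (s1) s10].
    apply: uniq_srcs_cat => //.
      apply: uniq_srcs_cat => // x x1 xt; move/hasPn: h1 => /(_ _ x1) /=.
      by rewrite tB.
    move=> x; rewrite srcs_cat mem_cat inE => xst /eqP xl; move: xst; rewrite xl.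
    case/orP=> [x1|]; last by apply/negP.
    by move/hasPn: h1 => /(_ _ x1) /=; rewrite /src /= lB.
  rewrite lcol_cat !cf_cat c1 lcol_nnil // ct /=.
  have st0 : s1 ++ t != [::] by case: (s1) s10.
  by rewrite (lcol_nnil _ st0) cf_cons nl.
move: (wB); rewrite (region_absorb reg cyc) //.
  by apply/hasP; exists l => //; rewrite srcs_cat mem_cat orbC mem_head.
case: (s1) s10 w1 => [|d s] //= _ /and3P[_ /eqP<- _].
by rewrite mem_head.
Qed.

(** The case [None] provides a valid pair to start from, even in a graph without cusps. *)
Definition valid (x : V * option K) : Prop := x.2 = None \/ cusp_color x.1 x.2.

(** A cusp-point at [l] involves two distinct edges, one of which is not [e]; (H1) keeps its color
    apart from that of [e]. *)
Lemma valid_exit v a : v = l -> valid (v, a) -> ~~ clash a (Some (k e l)).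
Proof.
move=> -> [/= -> //|/= [f [g [fg fi gi -> [kg]]]]].
apply/negP=> /eqP[kf].
case: (eqVneq f e) => [fe|/(region_h1 reg fi)]; last by rewrite -kf eqxx.
have ge : g != e by rewrite -fe eq_sym.
by move: (region_h1 reg gi ge); rewrite -kg -kf eqxx.
Qed.

Lemma prec_exit v a : valid (v, a) -> v \in B ->
  prec (v, a) (w, Some (k e w)).
Proof.
move=> va vB; have [s [ws us ls cs sB]] := region_conn reg a vB lB.
have sub z : z \in srcs (s ++ [:: exit_dart]) -> z \in B.
  by rewrite srcs_cat mem_cat inE => /orP[/sB|/eqP->].
exists (s ++ [:: exit_dart]); split=> /=.
- apply/and4P; split; first exact: walk_cat ws walk_exit.
  + by apply: uniq_srcs_cat => // z zs; rewrite inE => /eqP zl; rewrite zl in zs;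
      rewrite zs in ls.
  + by apply: contra wB => /sub.
  + by case: (s).
- rewrite cf_cat cs cf_cons andbT /=.
  (* An empty [s] means [v = l], where [a] meets the exit edge directly. *)
  case: (eqVneq s [::]) ws sB => [->|s0] ws sB.
    by apply: valid_exit va; apply/eqP.
  rewrite lcol_nnil //; apply/negP => /(exit_in_lcol ws)[s' [d [def dw _]]].
  by move: wB; rewrite -dw sB // def /srcs map_rcons mem_rcons mem_head.
- by rewrite lcol_cat.
- case=> q [z [wq uq cq zs _]].
  move: (exit_noreturn wq uq cq); rewrite has_rcons negb_or /=.
  by rewrite sub.
Qed.

End Region.

(** * Rotation of cycles, and arcs of cusp-free cycles *)

Lemma vcycle_rot v s1 d s2 : vcycle v (s1 ++ d :: s2) ->
  vcycle (src d) (d :: s2 ++ s1).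
Proof.
case/and3P=> ws us _; have [w1 w2] := walk_split_src ws.
apply/and3P; split=> //; first exact: (walk_cat w2 w1).
by rewrite -cat_cons srcs_cat uniq_catC -srcs_cat.
Qed.

Lemma cfcycle_rot v s1 d s2 : cfcycle v (s1 ++ d :: s2) ->
  cfcycle (src d) (d :: s2 ++ s1).
Proof.
case/andP=> cs; rewrite lcol_cat cf_cat => /andP[c1 c2].
rewrite /cfcycle (vcycle_rot cs) -cat_cons lcol_cat cf_cat.
have L b : lcol b (d :: s2) = lcol None (d :: s2) by [].
rewrite !L in c1 c2 *; rewrite c1 andbT.
case: (eqVneq s1 [::]) c2 => [-> //|s10].
by rewrite !(lcol_nnil _ s10).
Qed.

(* At [y] the two directions along the cycle have different colors, so at least
   one of them avoids [b]. *)
Lemma cfcycle_arc x t y z b : cfcycle x t -> y \in srcs t -> z \in srcs t ->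
  exists s, [/\ walk y s z, uniq (srcs s), z \notin srcs s, cf b s None &
                {subset srcs s <= srcs t}].
Proof.
move=> ct /srcs_split[t1 [d [t2 [deft <-]]]]; rewrite {}deft in ct * => zt.
have ct' := cfcycle_rot ct.
have {}zt : z \in srcs (d :: t2 ++ t1).
  by rewrite -cat_cons srcs_cat mem_cat orbC -mem_cat -srcs_cat.
have sub : {subset srcs (d :: t2 ++ t1) <= srcs (t1 ++ d :: t2)}.
  by move=> u; rewrite -cat_cons !srcs_cat !mem_cat orbC.
case/srcs_split: zt => r1 [f [r2 [deft fz]]]; rewrite {}deft in ct' sub.
have sub1 : {subset srcs r1 <= srcs (t1 ++ d :: t2)}.
  by move=> u u1; apply: sub; rewrite srcs_cat mem_cat u1.
have sub2 : {subset srcs (f :: r2) <= srcs (t1 ++ d :: t2)}.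
  by move=> u u2; apply: sub; rewrite srcs_cat mem_cat u2 orbT.
have /andP[/and3P[wt ut _] cc] := ct'.
have [w1 w2] := walk_split_src wt; have [u1 u2 dis] := uniq_srcs_catE ut.
have zr1 : src f \notin srcs r1 by apply/negP => /dis; apply; exact: mem_head.
(* If the direct arc [r1] starts with color [b], the opposite arc [rs (f :: r2)] does not, as the
   cycle has no cusp at [y]. *)
have [cl|ncl] := boolP (clash b (fcol r1)); last first.
  exists r1; split; rewrite -?fz //.
  have [-> //|r10] := eqVneq r1 [::]; first by rewrite /cf /= clash_None.
  apply: cf_join; rewrite ?clash_None //.
  by move: cc; rewrite cf_cat => /andP[/cf_None].
have r10 : r1 != [::] by case: (r1) cl; rewrite // clash_None.
have bE : b = fcol r1.
  by case: b cl => [c|] //=; case: fcol => // c' /eqP[->].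
have drf : src d \notin srcs (f :: r2).
  apply/negP => /dis; apply; case: (walk_head w1) => // -[r1n].
  by rewrite r1n in r10.
have := uniq_srcs_rs w2; rewrite [RHS]cons_uniq drf [X in _ && X]u2.
case/andP=> z2 u2'.
exists (rs (f :: r2)); split=> //; rewrite -?fz //; first exact: walk_rs.
  rewrite cf_rs; apply: cf_join => //=.
    by move: cc; rewrite cf_cat => /andP[_ /cf_None].
  move: (cf_first cc); rewrite lcol_cat lcol_nnil // fcol_cat // -bE.
  by [].
move=> u u2''; have := mem_srcs_rs u w2; rewrite inE u2'' orbT => /esym.
rewrite inE => /orP[/eqP->|/sub2//]; apply: sub1.
by case: (walk_head w1) => // -[r1n]; rewrite r1n in r10.
Qed.

(** * Maximal pairs *)

Section Maximal.
Variables (v : V) (a : option K).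
Hypothesis va : valid (v, a).
Hypothesis vmax : forall y : V * option K, valid y -> ~ prec (v, a) y.
Hypothesis regions : forall x s u, cfcycle x s -> u \in srcs s ->
  exists B l w e, exit_region B l w e /\ u \in B.

Lemma max_notin_region B l w e : exit_region B l w e -> v \notin B.
Proof.
move=> reg; apply/negP => vB.
by apply: (vmax _ (prec_exit reg va vB)); right; exact: region_h2 reg.
Qed.

(** * A cycle at [v] with the fewest cusps, cut at its first cusp *)

Section Shortest.
Variables (A r : seq dart) (d : dart) (N : nat).
Let s := A ++ d :: r.
Hypothesis gs : good v s.
Hypothesis sa : ~~ clash a (fcol s).
Hypothesis minN : forall s, good v s -> ~~ clash a (fcol s) ->
  N <= ncusp None s None.
Hypothesis A0 : A != [::].
Hypothesis cA : cf None A None.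
Hypothesis Ad : clash (lcol None A) (Some (kout d)).
Hypothesis NR : ncusp None (d :: r) None < N.

Let ws : walk v s v. Proof. by case/andP: gs => /and3P[]. Qed.
Let us : uniq (srcs s). Proof. by case/andP: gs => /and3P[]. Qed.
Let wA : walk v A (src d). Proof. by case: (walk_split_src ws). Qed.
Let wr : walk (src d) (d :: r) v. Proof. by case: (walk_split_src ws). Qed.
Let uA : uniq (srcs A). Proof. by case: (uniq_srcs_catE us). Qed.
Let ur : uniq (srcs (d :: r)). Proof. by case: (uniq_srcs_catE us). Qed.
Let Ar z : z \in srcs A -> z \in srcs (d :: r) -> False.
Proof. by case: (uniq_srcs_catE us) => _ _; apply. Qed.
Let fs : fcol s = fcol A. Proof. exact: fcol_cat. Qed.
Let vs : ~~ clash (lcol None (d :: r)) (fcol A).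
Proof. by case/andP: gs => _; rewrite fs /s lcol_cat lcol_nnil. Qed.
Let ca : cf a A None.
Proof. by apply: cf_join; rewrite ?clash_None // -fs. Qed.

Lemma outside_cusp_prec :
  (forall x t, cfcycle x t -> src d \in srcs t -> False) ->
  prec (v, a) (src d, lcol None A).
Proof.
move=> ncyc; exists A; split=> //=.
  apply/and4P; split=> //; apply/negP => /Ar; apply; exact: mem_head.
case=> q [z [wq uq cq zA _]].
case: q wq uq cq => [|f q] wq uq cq.
  by move: (eqP wq) zA => <- /Ar; apply; exact: mem_head.
have fd := walk_first wq.
have dA : src d \notin srcs A by apply/negP => /Ar; apply; exact: mem_head.
have cf' : cf (lcol None (A ++ [::])) (f :: q) None by rewrite cats0.
(* Here [Q] is empty and [T] is the single dart [d]. As [A] ends with the color with which [d]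
   starts, [f] avoids the color of [d] as well. *)
apply: (detour_hit (Q := [::]) (T := [:: d]) (D := r) (a := a) _ _ _ _ _ wr ur
   _ vs _ _ NR _ _ wq uq cf') => //; rewrite ?cats0 //.
- by move=> x xr; rewrite ?cats0 => xA; apply: (Ar xA); rewrite [srcs _]/= inE xr orbT.
- by move=> x t cx tx _; apply: ncyc cx _; rewrite -fd.
- case/lastP: (A) Ad cq => [|A' e] //.
  rewrite -cats1 lcol_cat /= => /eqP[->]; rewrite cf_cons => /andP[].
  by rewrite clash_sym.
- move=> x; rewrite mem_rcons in_cons => xzq; rewrite /= inE => /eqP xd.
  case/orP: xzq => [/eqP xz|xq]; first by rewrite -xz xd (negbTE dA) in zA.
  by move: uq; rewrite /= fd -xd xq.
- by left.
Qed.

Variables (B : {set V}) (l w : V) (e : E).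
Hypothesis reg : exit_region B l w e.
Hypothesis dB : src d \in B.

Let lB := region_l reg.
Let wB := region_w reg.
Let vB := max_notin_region reg.

Lemma inside_cusp_prec : prec (v, a) (w, Some (k e w)).
Proof.
have hA : has (mem B) (rcons (srcs A) (src d)) by rewrite has_rcons /= dB.
(* Of the cycle only two ends are kept: [A1], up to its first vertex in [B], and [D], after the last
   dart [y] starting in [B]. *)
have [A1 [u [A2 [defA wA1 _ /= uB nA1]]]] := first_hit wA hA.
have A1B x : x \in srcs A1 -> x \in B -> False.
  by move=> x1 xB; move/hasPn: nA1 => /(_ x x1); rewrite /= xB.
have A1A x : x \in srcs A1 -> x \in srcs A.
  by rewrite defA srcs_cat mem_cat => ->.
have hr : has (mem B) (srcs (d :: r)) by rewrite /= dB.
have [r1 [y [D [defr /= yB nD]]]] := last_hit hr.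
have DB x : x \in srcs D -> x \in B -> False.
  by move=> xD xB; move/hasPn: nD => /(_ x xD); rewrite /= xB.
have yDr x : x \in srcs (y :: D) -> x \in srcs (d :: r).
  by rewrite defr [srcs (r1 ++ _)]srcs_cat mem_cat => ->; rewrite orbT.
have A10 : A1 != [::].
  by apply: contraNneq vB => A1n; move: wA1; rewrite A1n /= => /eqP->.
have fA1 : fcol A1 = fcol A by rewrite defA fcol_cat.
have [Q [wQ uQ lQ cQ QB]] := region_conn reg (lcol None A1) uB lB.
(* With [kout y] as incoming color, the reversal of [S] leads from [l] to [y] and continues along it
   without a cusp. *)
have [S [wS uS lS cS SB]] := region_conn reg (Some (kout y)) yB lB.
have wP := walk_cat wA1 wQ.
have lP : l \notin srcs (A1 ++ Q).
  rewrite srcs_cat mem_cat negb_or lQ andbT.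
  by apply/negP => /A1B; apply.
have caA1 : cf a A1 None by move: ca; rewrite defA cf_cat => /andP[].
have cP : cf a (A1 ++ Q) None by rewrite cf_cat caA1 lcol_nnil.
have uA1 : uniq (srcs A1) by move: uA; rewrite defA => /uniq_srcs_catE[].
have uP : uniq (srcs (A1 ++ Q)).
  by apply: uniq_srcs_cat => // x /A1B nx /QB.
have wyD : walk (src y) (y :: D) v.
  have [] // : walk (src d) r1 (src y) /\ walk (src y) (y :: D) v.
  by apply: walk_split_src; rewrite -defr.
have uyD : uniq (srcs (y :: D)).
  by move: ur; rewrite defr => /uniq_srcs_catE[].
(* Including [y] makes [T] non-empty even if [S] is empty, while its sources stay in [B]. *)
pose T := rcons (rs S) y.
have TDE : T ++ D = rs S ++ y :: D by rewrite /T -cats1 -catA.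
have wR : walk l (T ++ D) v by rewrite TDE; apply: walk_cat (walk_rs wS) wyD.
have := uniq_srcs_rs wS; rewrite [RHS]cons_uniq lS [X in _ && X]uS.
case/andP=> yS urS.
have rSB x : x \in srcs (rs S) -> x \in B.
  move=> xS; have := mem_srcs_rs x wS; rewrite inE xS orbT => /esym.
  by rewrite inE => /orP[/eqP->//|/SB].
have TB x : x \in srcs T -> x \in B.
  by rewrite /T -cats1 srcs_cat mem_cat inE => /orP[/rSB|/eqP->].
have uR : uniq (srcs (T ++ D)).
  rewrite TDE; apply: uniq_srcs_cat => // x xS; rewrite inE => /orP[/eqP xy|xD].
    by rewrite -xy xS in yS.
  by apply: DB xD _; apply: rSB.
have T0 : T != [::] by rewrite /T; case: (rs S).
have cT : cf None T None.
  by rewrite /T -cats1 cf_mid cf_rs cS.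
have NTD : ncusp None (T ++ D) None < N.
  apply: leq_ltn_trans NR; rewrite ncusp_cat (eqP cT) add0n defr ncusp_cat.
  by rewrite /T -cats1 lcol_cat /= addnA leq_addl.
have lR : lcol None (T ++ D) = lcol None (d :: r).
  by rewrite TDE defr !lcol_cat.
have vR : ~~ clash (lcol None (T ++ D)) (fcol A1) by rewrite lR fA1.
have AR x : x \in srcs A1 -> x \in srcs (T ++ D) -> False.
  move=> x1; rewrite srcs_cat mem_cat => /orP[/TB|xD]; first exact: A1B.
  by apply: (Ar (A1A _ x1)); apply: yDr; rewrite inE xD orbT.
have DP x : x \in srcs D -> x \in srcs (A1 ++ Q) -> False.
  move=> xD; rewrite srcs_cat mem_cat => /orP[x1|/QB]; last exact: DB.
  by apply: (Ar (A1A _ x1)); apply: yDr; rewrite inE xD orbT.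
(* [Q] and [S] may cross inside [B]. If one of them is empty, the two walks form a cycle at [v],
   which has fewer than [N] cusps unless they clash at [l]. *)
have joinPR : (Q == [::]) || (S == [::]) -> clash (lcol None (A1 ++ Q)) (fcol T).
  move=> QS; apply: contraLR NTD => ncl; rewrite -leqNgt.
  have P0 : A1 ++ Q != [::] by case: (A1) A10.
  have R0 : T ++ D != [::] by case: (T) T0.
  have fPR : fcol ((A1 ++ Q) ++ (T ++ D)) = fcol A1 by rewrite !fcol_cat.
  have -> : ncusp None (T ++ D) None =
            ncusp None ((A1 ++ Q) ++ (T ++ D)) None.
    rewrite [RHS]ncusp_cat (eqP (cf_None cP)).
    rewrite (ncusp_split (lcol None (A1 ++ Q)) _ R0) clash_None.
    by rewrite fcol_cat // (negbTE ncl) addn0.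
  apply: minN; last by rewrite fPR fA1 -fs.
  apply/andP; split; last by rewrite fPR lcol_cat lcol_nnil.
  apply/and3P; split; [exact: walk_cat wP wR| |by case: (A1) A10].
  apply: uniq_srcs_cat => // x xP xR.
  move: (xP) (xR); rewrite srcs_cat mem_cat => /orP[/AR|xQ]; first exact.
  rewrite TDE srcs_cat mem_cat => /orP[xS|].
    by case/orP: QS => /eqP QS; [rewrite QS in xQ|rewrite QS in xS].
  rewrite inE => /orP[/eqP xy|xD]; last exact: DP xD xP.
  case/orP: QS => /eqP QS; first by rewrite QS in xQ.
  move: wS lQ; rewrite QS /= => /eqP<-.
  by rewrite -xy xQ.
(* By (H1) such a [T] begins by crossing [e] to [w]. A first dart taken from [rs S] would stay in
   [B], so [S] is empty and this dart is [y]. *)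
have nclT' (t : dart) T' : T = t :: T' -> clash (Some (k e l)) (fcol T) ->
    [/\ S = [::], t = y & edg y = e].
  move=> defT; rewrite defT => cl.
  have /and3P[pt st _] : walk l (t :: T' ++ D) v by move: wR; rewrite defT.
  have [tw te] := exit_out reg pt (eqP st) cl.
  move: defT; rewrite /T; case: (lastP S) SB => [|S1 f] SB.
    move=> /= [yt _]; subst t.
    by split.
  rewrite -(cats1 S1) rs_cat /= => -[tf _].
  by move: wB; rewrite -tw -tf SB // -cats1 srcs_cat mem_cat orbC mem_head.
have [h [T' defT]] : exists h T', T = h :: T'.
  by case: (T) T0 => // h T' _; exists h, T'.
(* Otherwise [A1 ++ Q] arrives along [e] from [w], so [Q] is empty; then [T] also starts with the
   color of [e], and the cycle crosses [e] twice, against [good_edges]. *)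
have nclP : ~~ clash (lcol None (A1 ++ Q)) (Some (k e l)).
  apply/negP => cl; have [p [f [defP fw fe]]] := exit_in_lcol reg wP cl.
  have Qn : Q = [::].
    case/lastP: Q defP QB {wQ uQ lQ cQ wP lP cP uP DP joinPR cl} => [|Q f'] //.
    rewrite -rcons_cat => /rcons_inj[_ ->] QB.
    by move: wB; rewrite -fw QB // -cats1 srcs_cat mem_cat orbC mem_head.
  have clT : clash (Some (k e l)) (fcol T).
    have := joinPR; rewrite Qn eqxx => /(_ isT); rewrite Qn in cl.
    by case: lcol cl => [c|] //= /eqP[->].
  have [Sn ty ye] := nclT' _ _ defT clT.
  have sE : s = p ++ f :: (A2 ++ r1) ++ y :: D.
    rewrite /s defA defr; move: defP; rewrite Qn cats0 => ->.
    by rewrite -cats1 -!catA.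
  by have := gs; rewrite sE => /good_edges; rewrite fe ye eqxx.
have nclT : ~~ clash (Some (k e l)) (fcol T).
  apply/negP => clT; have [Sn _ _] := nclT' _ _ defT clT.
  have := joinPR; rewrite Sn eqxx orbT => /(_ isT) cl.
  move: nclP; rewrite /=; case: fcol clT cl => [c|] //= /eqP[<-] cl.
  by rewrite cl.
have fresh x t0 : cfcycle x t0 -> src (exit_dart l w e) \in srcs t0 ->
    tgt (exit_dart l w e) \in srcs t0 -> False.
  move=> ct lt wt; move: wB; rewrite (region_absorb reg ct) //.
  by apply/hasP; exists l.
have we := walk_exit reg.
(* The path [q] avoids [B] by [exit_noreturn], hence also [Q] and [T], and the exit dart followed by
   [q] is a detour from [l]. *)
have det q z : walk w q z -> uniq (srcs q) -> cf (Some (k e w)) q None ->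
    z \in srcs A1 \/ z \in srcs D -> False.
  move=> wq uq cq; have nq := exit_noreturn reg wq uq cq.
  apply: (detour_hit wP cP uP A10 lP wR uR T0 vR AR DP NTD minN fresh
           (d := exit_dart l w e) (q := q)) => //.
  - exact: walk_cat we wq.
  - rewrite cons_uniq [X in _ && X]uq andbT; apply/negP => lq.
    move/hasPn: nq => /(_ l); rewrite mem_rcons inE lq orbT /= lB.
    by move=> /(_ isT).
  - by rewrite cf_cons nclP.
  - move=> x xq xQT; move/hasPn: nq => /(_ x xq) /=.
    by case/orP: xQT => [/QB|/TB] ->.
have nw : walk w [::] w by rewrite /=.
(* Applied to the empty path, [det] shows that the exit edge does not itself land on [A1]. *)
have nwA : w \notin srcs A1.
  by apply/negP => wA1'; apply: (det [::] w nw) => //; left.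
exists ((A1 ++ Q) ++ [:: exit_dart l w e]); split=> /=.
- apply/and4P; split; first exact: walk_cat wP we.
  + by apply: uniq_srcs_cat => // x xP; rewrite inE => /eqP xl; rewrite xl in xP;
      rewrite xP in lP.
  + rewrite !srcs_cat !mem_cat !negb_or nwA /=.
    apply/and3P; split=> //; first by apply: contra wB => /QB.
    by rewrite eq_sym (exit_lw reg).
  + by case: (A1) A10.
- rewrite cf_cat cP cf_cons andbT /= lcol_nnil //.
  by case: (A1) A10.
- by rewrite lcol_cat.
- case=> q [z [wq uq cq zP _]].
  have := exit_noreturn reg wq uq cq; rewrite has_rcons negb_or => /andP[nzB _].
  move: zP; rewrite !srcs_cat !mem_cat inE => /orP[/orP[zA|/QB zB]|/eqP zl].
  + by apply: (det q z) => //; left.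
  + by rewrite /= zB in nzB.
  + by rewrite /= zl lB in nzB.
Qed.

End Shortest.

Lemma max_no_good s : ~ good v s.
Proof.
suff key N t : good v t -> ~~ clash a (fcol t) -> ncusp None t None = N -> False.
  move=> gs; have [cl|ncl] := boolP (clash a (fcol s)); last exact: key gs ncl erefl.
  have /andP[/and3P[ws us s0] ls] := gs.
  (* A cycle starting with color [a] is reversed: without a cusp at [v], it ends with another
     color. *)
  have grs : good v (rs s).
    rewrite /good lcol_rs fcol_rs clash_sym ls andbT.
    apply/and3P; split; [exact: walk_rs ws| |by rewrite rs_eq0].
    rewrite srcs_rs rev_uniq -(perm_uniq (s1 := srcs s)) //.
    by rewrite -(perm_cons v) -(srcs_walk ws) perm_sym perm_rcons.
  apply: (key _ _ grs _ erefl); rewrite fcol_rs.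
  case: a cl => [c|] //= /eqP fc; move: ls; rewrite fc clash_sym /=.
  by [].
(* Strong induction on the number of cusps plays the role of choosing a cycle with the fewest. *)
elim/ltn_ind: N t => N IH t gt ta tN.
have minN t' : good v t' -> ~~ clash a (fcol t') -> N <= ncusp None t' None.
  by move=> g' a'; rewrite leqNgt; apply/negP => lt; apply: (IH _ lt t').
have ncv x t' : cfcycle x t' -> v \in srcs t' -> False.
  move=> ct vt; have [B [l [w [e [reg vB]]]]] := regions ct vt.
  by move: (max_notin_region reg); rewrite vB.
have [N0|N0] := eqVneq N 0.
  apply: (ncv v t); first by apply: good_cfcycle; rewrite // tN.
  have /andP[/and3P[wt _ t0] _] := gt.
  by case: (walk_head wt) => // -[tn]; rewrite tn in t0.
have n0 : ncusp None t None != 0 by rewrite tN.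
have [A [d [r [deft cA cl]]]] := first_cusp n0.
have A0 : A != [::] by case: (A) cl.
rewrite deft in gt ta.
have NR : ncusp None (d :: r) None < N.
  rewrite -tN deft ncusp_cat (eqP cA) /= cl.
  by rewrite add0n add1n ltnS.
(* Either the first cusp is at a vertex of a cusp-free cycle, hence of a region, or it is outside
   all cusp-free cycles. *)
have [[x [t' [ct dt]]]|nc] :=
    pselect (exists x t', cfcycle x t' /\ src d \in srcs t').
  have [B [l [w [e [reg dB]]]]] := regions ct dt.
  apply: (vmax _ (inside_cusp_prec gt ta minN A0 cA NR reg dB)).
  by right; exact: region_h2 reg.
have lA : exists f A', A = rcons A' f by case/lastP: (A) A0 => // A' f; exists f, A'.
apply: (vmax _ (outside_cusp_prec gt ta minN A0 cA cl NR _)); last first.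
  by move=> x t' ct dt; apply: nc; exists x, t'.
right; case: lA => f [A' defA].
have /andP[/and3P[wt _ _] _] := gt.
have gt' := gt; rewrite defA -cats1 -catA in gt'.
(* A cusp-point requires distinct edges; this is the case of consecutive darts. *)
have fd := good_edges (Y := [::]) gt'.
have [wA wr] := walk_split_src wt.
have pd : is_dart d by apply: (walk_is_dart wt); rewrite mem_cat mem_head orbT.
have pf : is_dart f.
  by apply: (walk_is_dart wt); rewrite defA mem_cat mem_rcons mem_head.
have tf : tgt f = src d.
  by move: wA; rewrite defA -cats1 => /walk_split_src[_ /and3P[_ _ /eqP]].
exists (edg f), (edg d); split=> //=.
- by rewrite -tf; case: (dart_inc pf).
- by case: (dart_inc pd).
- by rewrite defA -cats1 lcol_cat /lcol /= /kin tf.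
- by case: lcol cl => [c|] //= /eqP[<-].
Qed.

End Maximal.
End Darts.

(** * Cusps of a cycle as pairs of cyclically consecutive darts *)

Section Consecutive.
Variables (V E : finType) (K : eqType) (inc : E -> {set V}) (k : E -> V -> K).
Implicit Types (d : dart V E) (s : seq (dart V E)).

Lemma cf_zip d s e :
  cf k (Some (kin k d)) s (Some (kout k e)) =
  all (fun p => kin k p.1 != kout k p.2) (zip (d :: s) (rcons s e)).
Proof.
elim: s d => [|f s IH] d; first by rewrite /cf /= eqb0 andbT eq_sym.
by rewrite cf_cons IH /= eq_sym.
Qed.

Lemma cfcycle_zip v s : vcycle inc v s ->
  cfcycle inc k v s =
  all (fun p => kin k p.1 != kout k p.2) (zip s (rot 1 s)).
Proof.
move=> cs; rewrite /cfcycle cs /=; case: s cs => [|d s] //= _.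
rewrite rot1_cons -cf_zip cf_cons andbC.
rewrite -[in RHS](cats0 s) cf_cat; congr (_ && _).
by rewrite /cf /= eqb0.
Qed.

Lemma walk_zip d s e : walk inc (tgt d) s (src e) ->
  all (fun p => tgt p.1 == src p.2) (zip (d :: s) (rcons s e)).
Proof.
elim: s d => [|f s IH] d /=; first by move=> ->.
by case/and3P=> _ /eqP-> /IH /= ->; rewrite eqxx.
Qed.

Lemma vcycle_zip v s p : vcycle inc v s -> p \in zip s (rot 1 s) ->
  [/\ tgt p.1 = src p.2, p.1 \in s, p.2 \in s, is_dart inc p.1 & is_dart inc p.2].
Proof.
case/and3P=> ws _ _ pz.
have /andP[p1] := mem_zip pz; rewrite mem_rot => p2.
split=> //; try exact: walk_is_dart ws _.
case: s ws pz {p1 p2} => [|d s] // /and3P[_ /eqP dv ws].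
by rewrite rot1_cons -dv in ws * => /(allP (walk_zip ws)) /eqP.
Qed.

(** Fills the gap between [vcycle], which constrains only vertices, and [is_cycle], which also asks
    for distinct edges. *)
Lemma cfcycle_uniq_edges v s : cfcycle inc k v s -> uniq (map (@edg V E) s).
Proof.
move=> cs; have gs : good inc k v s.
  case/andP: cs => cs cc; rewrite /good cs /=.
  by apply: cf_first cc.
have : forall X d Y e Z, s = X ++ d :: Y ++ e :: Z -> edg d != edg e.
  by move=> X d Y e Z sE; rewrite sE in gs; exact: good_edges gs.
elim: s {cs gs} => [|d s IH] //= h; rewrite IH ?andbT.
  apply/negP => /mapP[e es de]; case/path.splitPr: es h => Y Z.
  by move=> /(_ [::] d Y e Z erefl); rewrite de eqxx.
by move=> X e Y f Z sE; apply: (h (d :: X) e Y f Z); rewrite sE.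
Qed.

Lemma vcycle_mem_tgt v s : vcycle inc v s ->
  perm_eq (map (@tgt V E) s) (srcs s).
Proof.
case/and3P=> ws _ _.
by rewrite -(perm_cons v) -(srcs_walk ws) perm_rcons.
Qed.

End Consecutive.

(** * Back to partial graphs *)

Section Graph.
Variables (G : pgraph).
Implicit Types (H : sub_graph G) (x y u v : vertex G).
Local Notation ddart := (dart (vertex G) (edge G)).
Local Notation inc := (@ends G).

Fixpoint darts x (p : seq (edge G * vertex G)) : seq ddart :=
  if p is (e, y) :: q then (x, e, y) :: darts y q else [::].
Definition undarts (s : seq ddart) : seq (edge G * vertex G) :=
  [seq (edg d, tgt d) | d <- s].

Lemma dartsK x p : undarts (darts x p) = p.
Proof. by elim: p x => [|[e y] p IH] x //=; rewrite IH. Qed.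

Lemma edges_undarts s : path_edges (undarts s) = map (@edg _ _) s.
Proof. by rewrite /path_edges /undarts -map_comp. Qed.

Lemma targets_undarts s : path_targets (undarts s) = map (@tgt _ _) s.
Proof. by rewrite /path_targets /undarts -map_comp. Qed.

Lemma sub_ends_whole e : sub_ends (whole G) e = ends e.
Proof. exact: setIT. Qed.

Lemma walk_darts x p : is_path (whole G) x p ->
  walk inc x (darts x p) (path_end x p).
Proof.
elim: p x => [|[e y] p IH] x //=.
case=> _ _ /eqP ne; rewrite sub_ends_whole => ee /IH w.
by rewrite /is_dart ne /edg /src /tgt /= ee !eqxx.
Qed.

Lemma undarts_path x s y : walk inc x s y -> is_path (whole G) x (undarts s) /\
  path_end x (undarts s) = y.
Proof.
elim: s x => [|d s IH] x /=; first by move/eqP->; rewrite inE.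
case/and3P=> /andP[/eqP ne /eqP ed] /eqP<- /IH[ps <-].
by split=> //; rewrite !inE sub_ends_whole.
Qed.

Lemma vcycle_darts x p : is_cycle x p ->
  vcycle inc x (darts x p) /\ uniq (path_edges p).
Proof.
case=> /walk_darts wp [ue ub ut] pe p0; split=> //.
rewrite pe in wp; apply/and3P; split=> //.
  have := srcs_walk wp; rewrite -targets_undarts dartsK => h.
  suff -> : srcs (darts x p) = belast x (path_targets p) by [].
  have := lastI x (path_targets p); rewrite -h.
  by case/rcons_inj.
by case: (p) p0 => // -[].
Qed.

Lemma undarts_cycle x s : vcycle inc x s -> uniq (map (@edg _ _) s) ->
  is_cycle x (undarts s).
Proof.
move=> cs ue; have /and3P[ws us s0] := cs.
have [ps pe] := undarts_path ws.
split=> //; last by case: (s) s0.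
split; rewrite ?edges_undarts ?targets_undarts //.
  have := srcs_walk ws; rewrite lastI => /rcons_inj[<- _].
  exact: us.
by rewrite (perm_uniq (vcycle_mem_tgt cs)).
Qed.

Lemma cycle_vertices x s : vcycle inc x s ->
  vertices (path_sub_graph x (undarts s)) =i srcs s.
Proof.
move=> cs u; rewrite inE targets_undarts inE (perm_mem (vcycle_mem_tgt cs)).
case/and3P: cs => ws _ s0; case: eqVneq => // ->.
by case: (walk_head ws) => [[sn]|->] //; rewrite sn in s0.
Qed.

Lemma cycle_edges x s :
  edges (path_sub_graph x (undarts s)) =i map (@edg _ _) s.
Proof. by move=> e; rewrite inE edges_undarts. Qed.

Lemma zip_undarts s : zip (undarts s) (rot 1 (path_edges (undarts s))) =
  [seq ((edg p.1, tgt p.1), edg p.2) | p <- zip s (rot 1 s)].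
Proof. by rewrite edges_undarts -map_rot map_zip. Qed.

(** * Colors and cusps of the graph in terms of darts *)

Variables (C : Type) (c : local_coloring G C).

Definition same_color e w f : Prop :=
  exists (we : w \in ends e) (wf : w \in ends f), c we = c wf.

(* The color of [e] at [w], represented by some edge of the same color at [w]. *)
Definition color_rep (e : edge G) (w : vertex G) : option (edge G) :=
  [pick f | `[< same_color e w f >]].

(** Edges of the same color at [w] define the same predicate, on which [pick] makes the same choice.
    A color depends on a proof of incidence, which [bool_irrelevance] makes harmless. *)
Lemma color_repP e w f : w \in ends e -> w \in ends f ->
  color_rep e w = color_rep f w <-> same_color e w f.
Proof.
move=> we wf; split.
  rewrite /color_rep; case: pickP => [g /asboolP[we1 [wg cg]]|]; last first.
    by move=> /(_ e) /asboolP[]; exists we, we.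
  case: pickP => [g' /asboolP[wf1 [wg' cg']]|//] [gg]; subst g'.
  exists we1, wf1; rewrite cg cg'.
  by rewrite (bool_irrelevance wg wg').
case=> we1 [wf1 cef]; apply: eq_pick => g; apply/asbool_equiv_eq; split.
  by case=> we2 [wg cg]; exists wf1, wg; rewrite -cef -cg (bool_irrelevance we1 we2).
by case=> wf2 [wg cg]; exists we1, wg; rewrite cef -cg (bool_irrelevance wf1 wf2).
Qed.

Local Notation k := color_rep.

Lemma cusp_zip x s p : vcycle inc x s -> uniq (map (@edg _ _) s) ->
  p \in zip s (rot 1 s) ->
  (cusp c (edg p.1) (tgt p.1) (edg p.2) <-> kin k p.1 = kout k p.2).
Proof.
move=> cs ue pz; have [tp m1 m2 p1 p2] := vcycle_zip cs pz.
have t1 : tgt p.1 \in ends (edg p.1) by case: (dart_inc p1).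
have t2 : tgt p.1 \in ends (edg p.2) by rewrite tp; case: (dart_inc p2).
rewrite /kin /kout -tp color_repP //; split=> [[]//|sc]; split=> // ee.
(* Equal edges would come from one dart following itself, hence with equal endpoints. *)
have {}ee := uniq_map_inj ue m1 m2 ee.
by case/andP: p1; rewrite tp ee eqxx.
Qed.

Lemma cycle_cuspP x s e w f : vcycle inc x s -> uniq (map (@edg _ _) s) ->
  cycle_cusp c (undarts s) e w f <->
  exists p, [/\ p \in zip s (rot 1 s), edg p.1 = e, tgt p.1 = w, edg p.2 = f &
                kin k p.1 = kout k p.2].
Proof.
move=> cs ue; rewrite /cycle_cusp zip_undarts; split.
  case=> /mapP[p pz [-> -> ->]] cu; exists p; split=> //.
  exact/(cusp_zip cs ue pz).
case=> p [pz <- <- <- kk]; split; last exact/(cusp_zip cs ue pz).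
by apply/mapP; exists p.
Qed.

Lemma cfcycle_cusp_free x s : cfcycle inc k x s ->
  cusp_free_cycle c (path_sub_graph x (undarts s)).
Proof.
move=> cs; have ue := cfcycle_uniq_edges cs.
have vs : vcycle inc x s by case/andP: cs.
exists x, (undarts s); split=> //; first exact: undarts_cycle.
move=> e w f /(cycle_cuspP _ _ _ vs ue)[p [pz _ _ _ kk]].
by move: cs; rewrite cfcycle_zip // => /allP/(_ p pz); rewrite kk eqxx.
Qed.

Lemma cusp_free_cfcycle K : cusp_free_cycle c K ->
  exists x s, [/\ cfcycle inc k x s, vertices K =i srcs s &
                  edges K =i map (@edg _ _) s].
Proof.
case=> x [p [cp cf ->]]; have [vs ue] := vcycle_darts cp.
rewrite -(dartsK x p) edges_undarts in ue.
exists x, (darts x p); split; last first.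
- by rewrite -{1}(dartsK x p); exact: cycle_edges.
- by rewrite -{1}(dartsK x p); exact: cycle_vertices.
rewrite cfcycle_zip //; apply/allP => q qz; apply/eqP => kk.
case: (cf (edg q.1) (tgt q.1) (edg q.2)); rewrite -(dartsK x p).
by apply/(cycle_cuspP _ _ _ vs ue); exists q.
Qed.

(** A cycle through [v] without a cusp there is rotated to start at [v]; a clash between its last
    and first darts would be a cusp of the original cycle at [v]. *)
Lemma not_splitting_good v : ~ splitting c v -> exists s, good inc k v s.
Proof.
move=> nsp; apply: contrapT => ngood; apply: nsp => x p cp vp.
apply: contrapT => ncu; apply: ngood.
have [vs ue] := vcycle_darts cp.
move: vp; rewrite -(dartsK x p) cycle_vertices // => vp.
have [s1 [d [s2 [sE dv]]]] := srcs_split vp.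
exists (d :: s2 ++ s1); move: (vs); rewrite sE => /vcycle_rot.
rewrite dv => vs'; rewrite /good vs' /=; apply/negP.
case/lastP E: (s2 ++ s1) vs' => [|X f] vs'.
  case/and3P: vs' => /and3P[/andP[nd _] /eqP dv' /eqP tv].
  by move: nd; rewrite dv' tv eqxx.
rewrite -rcons_cons -cats1 lcol_cat => /= /eqP[kk].
have fz := mem_zip_rot d E; rewrite -sE in fz.
have [/= tf _ _ _ _] := vcycle_zip vs fz.
apply: ncu; exists (edg f), (edg d); rewrite -(dartsK x p) in ue *.
rewrite edges_undarts in ue.
by apply/(cycle_cuspP _ _ _ vs ue); exists (f, d); split; rewrite //= tf.
Qed.

(** * Connectedness and maximal unions of cusp-free cycles *)

Lemma set2_ends e x y : x <> y -> [set x; y] \subset ends e ->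
  ends e = [set x; y].
Proof.
move=> /eqP ne sub; apply/esym/eqP; rewrite eqEcard sub cards2 ne.
exact: card_ends.
Qed.

(** Boolean adjacency inside [H], through which [joined] becomes the reachability relation
    [connect]. *)
Definition link H (u v : vertex G) : bool :=
  [&& u \in vertices H, v \in vertices H, u != v &
      [exists e in edges H, ends e == [set u; v]]].

Lemma link_sym H : symmetric (link H).
Proof.
move=> u v; rewrite /link andbCA eq_sym; congr [&& _, _, _ & _].
by apply: eq_existsb => e; rewrite setUC.
Qed.

Lemma joined_connect H u v : joined H u v -> connect (link H) u v.
Proof.
case=> p [pp <-]; elim: p u pp => [|[e y] p IH] u //=.
case=> uH eH /eqP ne se pp.
have /setIP[_ yH] : y \in sub_ends H e by rewrite se set22.
apply: connect_trans (IH _ pp); apply: connect1; rewrite /link uH yH ne /=.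
apply/existsP; exists e; rewrite eH; apply/eqP/set2_ends; first exact/eqP.
by rewrite -se subsetIl.
Qed.

Lemma connect_joined H u v : u \in vertices H -> connect (link H) u v ->
  joined H u v.
Proof.
move=> uH /connectP[p pp ->]; elim: p u uH pp => [|y p IH] u uH /=.
  by move=> _; exists [::].
case/andP=> /and4P[_ yH /eqP ne /existsP[e /andP[eH /eqP ee]]] /(IH _ yH).
case=> q [pq <-]; exists ((e, y) :: q); split=> //=.
split=> //; rewrite /sub_ends ee; apply/setIidPl/subsetP => z.
by rewrite !inE => /orP[] /eqP->.
Qed.

Lemma connectedI H u0 : u0 \in vertices H ->
  (forall u, u \in vertices H -> connect (link H) u0 u) ->
  (forall e, e \in edges H -> exists u, u \in sub_ends H e) -> connected H.
Proof.
move=> u0H cH eH.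
have jn u v : u \in vertices H -> v \in vertices H -> joined H u v.
  move=> uH vH; apply: connect_joined => //; apply: connect_trans (cH _ vH).
  by rewrite (sym_connect_sym (link_sym H)); exact: cH.
have inH e u : u \in sub_ends H e -> u \in vertices H by case/setIP.
split=> //; first by left; apply/eqP/set0Pn; exists u0.
  move=> e f /eH[u ue] /eH[v vf]; right; exists u, v; split=> //.
  by apply: jn; [exact: inH ue|exact: inH vf].
move=> e v /eH[u ue] vH; exists u; split=> //; apply: jn => //; exact: inH ue.
Qed.

Lemma link_incl H K u v : sub_incl H K -> connect (link H) u v ->
  connect (link K) u v.
Proof.
case=> /subsetP sv /subsetP se; apply: connect_sub => x y.
case/and4P=> /sv xK /sv yK ne /existsP[e /andP[/se eK ee]].
by apply: connect1; rewrite /link xK yK ne; apply/existsP; exists e; rewrite eK.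
Qed.

Lemma walk_connect H x s y : walk inc x s y -> {subset srcs s <= vertices H} ->
  y \in vertices H -> {subset map (@edg _ _) s <= edges H} ->
  forall u, u \in srcs s -> connect (link H) x u.
Proof.
elim: s x => [|d s IH] x //= /and3P[/andP[nd ed] /eqP<- ws] sv yH se u.
rewrite inE => /orP[/eqP->|us] //.
have sv' : {subset srcs s <= vertices H}.
  by move=> z zs; apply: sv; rewrite inE zs orbT.
apply: connect_trans (IH _ ws sv' yH _ u us); last first.
  by move=> e es; apply: se; rewrite inE es orbT.
apply: connect1; rewrite /link nd sv ?mem_head //=.
have -> : tgt d \in vertices H.
  by case: (walk_head ws) => [[_ ->]|/sv'].
by apply/existsP; exists (edg d); rewrite ed se ?mem_head.
Qed.

Lemma sub_incl_union (S : {set sub_graph G}) K : K \in S ->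
  sub_incl K (sub_union S).
Proof. by move=> KS; split; rewrite (bigcup_max K). Qed.

Lemma cycle_edge_ends K e : cusp_free_cycle c K -> e \in edges K ->
  ends e \subset vertices K.
Proof.
case/cusp_free_cfcycle=> x [s [/andP[vs _] vK eK]]; rewrite eK.
case/mapP=> d ds ->; have /and3P[ws _ _] := vs.
have /andP[_ /eqP->] := walk_is_dart ws ds.
apply/subsetP => z; rewrite vK !inE => /orP[] /eqP->; first exact: map_f.
by rewrite -(perm_mem (vcycle_mem_tgt vs)) map_f.
Qed.

Lemma cycle_ends K e : cusp_free_cycle c K -> e \in edges K ->
  exists u, u \in ends e.
Proof.
case/cusp_free_cfcycle=> x [s [/andP[/and3P[ws _ _] _] vK eK]]; rewrite eK.
case/mapP=> d ds ->; exists (src d).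
by case: (dart_inc (walk_is_dart ws ds)).
Qed.

Lemma cycle_connect K u v : cusp_free_cycle c K -> u \in vertices K ->
  v \in vertices K -> connect (link K) u v.
Proof.
case/cusp_free_cfcycle=> x [s [/andP[/and3P[ws us s0] _] vK eK]].
have xK : x \in vertices K.
  by rewrite vK; case: (walk_head ws) s0 => // -[->].
have cx z : z \in vertices K -> connect (link K) x z.
  rewrite vK; apply: (walk_connect ws _ xK) => y; first by rewrite vK.
  by rewrite eK.
move=> uK vK'; apply: connect_trans (cx _ vK').
by rewrite (sym_connect_sym (link_sym K)) cx.
Qed.

Lemma cusp_free_vertex K : cusp_free_cycle c K -> exists u, u \in vertices K.
Proof.
case/cusp_free_cfcycle=> x [s [/andP[/and3P[ws _ s0] _] vK _]].
by exists x; rewrite vK; case: (walk_head ws) s0 => // -[->].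
Qed.

Lemma connected_unionI (S : {set sub_graph G}) u0 :
  (forall K, K \in S -> cusp_free_cycle c K) ->
  u0 \in vertices (sub_union S) ->
  (forall u, u \in vertices (sub_union S) ->
     connect (link (sub_union S)) u0 u) ->
  connected_union c (sub_union S).
Proof.
move=> cS u0S conn; split; last by exists S.
apply: connectedI u0S conn _ => e /bigcupP[K KS eK].
have [u ue] := cycle_ends (cS K KS) eK; exists u; rewrite inE ue /=.
by apply/bigcupP; exists K => //; exact: (subsetP (cycle_edge_ends (cS K KS) eK)).
Qed.

(** In the enlarged union every vertex is reached from the shared vertex [u], either along [K] or
    inside [H]. *)
Lemma connected_union_add H K u : connected_union c H -> cusp_free_cycle c K ->
  u \in vertices H -> u \in vertices K ->
  exists H', [/\ connected_union c H', sub_incl H H' & sub_incl K H'].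
Proof.
case=> [[_ jH _ _] [S [cS HE]]] cK uH uK.
have incl : sub_incl H (sub_union (K |: S)).
  by rewrite HE; split; apply/bigcupsP => L LS; rewrite (bigcup_max L) ?inE ?LS ?orbT.
have inclK : sub_incl K (sub_union (K |: S)).
  by apply: sub_incl_union; rewrite setU11.
exists (sub_union (K |: S)); split=> //.
apply: (connected_unionI (u0 := u)).
- by move=> L; rewrite !inE => /orP[/eqP->|/cS].
- by case: inclK => /subsetP h _; apply: h.
- move=> v /bigcupP[L]; rewrite !inE => /orP[/eqP->|LS] vL.
    by apply: link_incl inclK _; apply: cycle_connect.
  apply: link_incl incl _; apply: joined_connect; apply: jH => //.
  by rewrite HE; apply/bigcupP; exists L.
Qed.

Lemma connected_union1 K : cusp_free_cycle c K ->
  exists H, connected_union c H /\ sub_incl K H.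
Proof.
move=> cK; have inclK : sub_incl K (sub_union [set K]).
  by apply: sub_incl_union; rewrite set11.
exists (sub_union [set K]); split=> //.
have [u uK] := cusp_free_vertex cK.
apply: (connected_unionI (u0 := u)).
- by move=> L /set1P->.
- by case: inclK => /subsetP h _; apply: h.
- move=> v /bigcupP[L /set1P-> vL].
  by apply: link_incl inclK _; apply: cycle_connect.
Qed.

(** Among the connected unions containing [K], one with the most vertices and edges in total is
    maximal for inclusion. *)
Lemma maximal_union_exists K : cusp_free_cycle c K ->
  exists H, maximal_connected_union c H /\ sub_incl K H.
Proof.
case/connected_union1 => H0 [cH0 KH0].
pose P H := `[< connected_union c H /\ sub_incl K H >].
have PH0 : P H0 by apply/asboolP.
case: (arg_maxnP (fun H => #|vertices H| + #|edges H|) PH0) => H.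
move=> /asboolP[cH KH] max; exists H; split=> //; split=> // L cL [sv se].
have PL : P L.
  apply/asboolP; split=> //; case: KH => kv ke.
  by split; [exact: subset_trans kv sv|exact: subset_trans ke se].
have : #|vertices L| + #|edges L| <= #|vertices H| + #|edges H| := max L PL.
rewrite leq_eqVlt ltnNge leq_add ?subset_leq_card // orbF.
move=> /eqP eqc.
have [lev lee] := (subset_leq_card sv, subset_leq_card se).
have ev : vertices H = vertices L.
  apply/eqP; rewrite eqEcard sv -(leq_add2r #|edges L|) eqc.
  by rewrite leq_add2l.
have ee : edges H = edges L.
  apply/eqP; rewrite eqEcard se -(leq_add2l #|vertices L|) eqc.
  by rewrite leq_add2r.
by move: ev ee; rewrite /vertices /edges; case: (L) (H) => [? ?] [? ?] /= -> ->.
Qed.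

Lemma maximal_absorb H x s u : maximal_connected_union c H ->
  cfcycle inc k x s -> u \in srcs s -> u \in vertices H ->
  {subset srcs s <= vertices H}.
Proof.
case=> cH max cs us uH.
have /andP[vs _] := cs; have cK := cfcycle_cusp_free cs.
have uK : u \in vertices (path_sub_graph x (undarts s)).
  by rewrite cycle_vertices.
have [H' [cH' HH' [/subsetP KH' _]]] := connected_union_add cH cK uH uK.
by move=> z zs; rewrite -(max _ cH' HH'); apply: KH'; rewrite cycle_vertices.
Qed.

(** By induction along a path of [H]: its last edge lies on a cusp-free cycle of the union. The walk
    built so far is followed to its first vertex on this cycle, and [cfcycle_arc] leads on to [z]
    without a cusp. *)
Lemma maximal_conn H u z a : maximal_connected_union c H ->
  u \in vertices H -> z \in vertices H ->
  exists s, [/\ walk inc u s z, uniq (srcs s), z \notin srcs s,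
                cf k a s None & {subset srcs s <= vertices H}].
Proof.
move=> mH uH zH; have [[[_ jH _ _] [S [cS HE]]] _] := mH.
have /connectP[p pp ->] := joined_connect (jH _ _ uH zH).
elim/last_ind: p pp {z zH} => [|p z IH].
  by move=> _; exists [::]; split; rewrite //= /cf /= clash_None.
rewrite rcons_path last_rcons => /andP[/IH[s [ws us ls cs sH]]].
set y := last u p in ws ls *.
case/and4P=> _ zH ne /existsP[e /andP[eH /eqP ee]].
have /bigcupP[K KS eK] : e \in edges (sub_union S) by rewrite -HE.
have cK := cS K KS; have /subsetP eKs := cycle_edge_ends cK eK.
have [x [t [ct vK _]]] := cusp_free_cfcycle cK.
have KH : {subset vertices K <= vertices H}.
  by rewrite HE; case: (sub_incl_union KS) => /subsetP.
have yt : y \in srcs t by rewrite -vK eKs // ee set21.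
have zt : z \in srcs t by rewrite -vK eKs // ee set22.
have ht : has (mem (srcs t)) (rcons (srcs s) y) by rewrite has_rcons /= yt.
have [s1 [w [s2 [sE w1 _ /= wt n1]]]] := first_hit ws ht.
have [r [wr ur lr cr rt]] := cfcycle_arc (lcol k a s1) ct wt zt.
have nt v : v \in srcs s1 -> v \in srcs t -> False.
  by move=> v1 vt; move/hasPn: n1 => /(_ v v1); rewrite /= vt.
exists (s1 ++ r); split.
- exact: walk_cat w1 wr.
- apply: uniq_srcs_cat => //; last by move=> v v1 /rt; exact: nt.
  by move: us; rewrite sE => /uniq_srcs_catE[].
- by rewrite srcs_cat mem_cat negb_or lr andbT; apply/negP => /nt; apply.
- by rewrite cf_cat cr andbT; move: cs; rewrite sE cf_cat => /andP[].
- move=> v; rewrite srcs_cat mem_cat => /orP[v1|/rt vt].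
    by apply: sH; rewrite sE srcs_cat mem_cat v1.
  by apply: KH; rewrite vK.
Qed.

End Graph.

(** * Omegas as exit regions, and the splitting vertex *)

Lemma exit_regionP (G : pgraph) (C : Type) (c : local_coloring G C)
    (x : exit_function c)
    (H1 : forall O, ~ cusp_point c (exit_l x O) (c _ _ (exit_l_end x O)))
    (H2 : forall O, cusp_point c (exit_w x O) (c _ _ (exit_w_end x O)))
    (O : Omega c) :
  exit_region (@ends G) (color_rep c) (vertices (sval O))
    (exit_l x O) (exit_w x O) (exit_edge x O).
Proof.
have mO := svalP O; split.
- exact: exit_l_in.
- exact: exit_w_out.
- exact: exit_ends.
- by move=> u z a uO zO; exact: maximal_conn.
- by move=> v s cs /hasP[u us uO]; exact: maximal_absorb mO cs us uO.
- move=> f lf fe; apply/eqP => /color_repP.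
  case=> //; first exact: exit_l_end.
  move=> lf' [le cfe]; apply: (H1 O); exists f, (exit_edge x O), lf'.
  split; last by rewrite cfe (bool_irrelevance le (exit_l_end x O)).
  by split; [exact/eqP|exists lf', le].
- have [f [g [wf [[fg [wf' [wg cfg]]] cf]]]] := H2 O.
  have we := exit_w_end x O.
  have ef : color_rep c (exit_edge x O) (exit_w x O) = color_rep c f (exit_w x O).
    by apply/color_repP => //; exists (exit_w_end x O), wf.
  exists f, g; split=> //; first exact/eqP; rewrite ef //.
  by congr Some; apply/color_repP => //; exists wf', wg.
Qed.

Theorem theorem8p3 (G : pgraph) (C : Type) (c : local_coloring G C)
  (x : exit_function c)
  (hG : 0 < #|vertex G|)
  (H1 : forall O : Omega c, ~ cusp_point c (exit_l x O) (c _ _ (exit_l_end x O)))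
  (H2 : forall O : Omega c, cusp_point c (exit_w x O) (c _ _ (exit_w_end x O))) :
  exists v : vertex G, splitting c v.
Proof.
have /card_gt0P[v0 _] := hG.
have v0v : valid (@ends G) (color_rep c) (v0, None) by left.
(* The values of [color_rep] form a finite type although [C] is arbitrary, so a maximal valid pair
   exists. *)
have [[v a] [va vmax]] := exists_max (@prec_irrefl _ _ _ (@ends G) (color_rep c))
  (@prec_trans _ _ _ (@ends G) (color_rep c)) v0v.
exists v; apply: contrapT => /not_splitting_good[s].
apply: (max_no_good va vmax) => y t u ct ut.
have [H [mH [/subsetP KH _]]] := maximal_union_exists (cfcycle_cusp_free ct).
pose O : Omega c := exist _ H mH.
exists (vertices H), (exit_l x O), (exit_w x O), (exit_edge x O).
split; first exact: (exit_regionP H1 H2 O).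
by apply: KH; rewrite cycle_vertices //; case/andP: ct.
Qed.
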